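(* Let $T_1$ and $T_2$ be two triangulations of a convex $(n+3)$-gon. Then the Santos associahedra $\mathrm{Ass}^{\mathrm{II}}_n(T_1)$ and $\mathrm{Ass}^{\mathrm{II}}_n(T_2)$ are normally isomorphic if and only if $T_1$ and $T_2$ are equivalent under rotation-reflection of the $(n+3)$-gon (i.e. under the dihedral group of order $2(n+3)$ acting on its cyclically labelled vertices).
   Context: Two complete fans in real vector spaces $V,V'$ of the same dimension are linearly isomorphic if there is a linear isomorphism $V\to V'$ sending each cone of one fan to a cone of the other. Two polytopes are normally isomorphic if their normal fans are linearly isomorphic. A diagonal of a convex polygon means an internal diagonal; two diagonals cross if they meet in a point interior to both. A triangulation of a convex $(n+3)$-gon (without new vertices) is identified with its set of $n$ pairwise non-crossing diagonals. Let $\alpha_1,\dots,\alpha_n$ be a basis of an $n$-dimensional real vector space $V$, and let $T_0=\{\delta_1,\dots,\delta_n\}$ be a (seed) triangulation of a convex $(n+3)$-gon. To each diagonal $pq$ associate $v_{pq}\in V$: $v_{pq}=-\alpha_i$ if $pq=\delta_i$, and $v_{pq}=\sum_{i:\ pq\text{ crosses }\delta_i}\alpha_i$ if $pq\notin T_0$. For each triangulation $T$ let $\mathbb R_{\ge0}T$ be the cone generated by $\{v_\delta:\delta\in T\}$. These cones are the maximal cones of a complete simplicial fan $\mathcal F_{T_0}$ in $V$, which is the normal fan of a polytope; $\mathrm{Ass}^{\mathrm{II}}_n(T_0)$ denotes any polytope with normal fan $\mathcal F_{T_0}$ (well defined up to normal isomorphism). *)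

(* Defs.v *)
From HB Require Import structures.
From mathcomp Require Import all_boot all_order all_algebra.
From mathcomp Require Import boolp classical_sets reals.

Set Implicit Arguments.
Unset Strict Implicit.
Unset Printing Implicit Defensive.

Import Order.TTheory GRing.Theory Num.Theory.

Local Open Scope classical_set_scope.
Local Open Scope ring_scope.

Section Polygon.
Variables (R : realType) (n : nat).

(* Twice the signed area of the triangle [a b c]. *)
Definition orientation (a b c : 'rV[R]_2) : R :=
  (b 0 0 - a 0 0) * (c 0 1 - a 0 1) - (b 0 1 - a 0 1) * (c 0 0 - a 0 0).

(* [p 0, p 1, ..., p (n + 2)] are the vertices of a convex (n+3)-gon, listed
   counterclockwise (no three of them on a line). *)
Definition convex_polygon (p : 'I_n.+3 -> 'rV[R]_2) : Prop :=
  forall i j k : 'I_n.+3, (i < j)%N -> (j < k)%N ->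
    0 < orientation (p i) (p j) (p k).

(* Internal diagonals, as pairs of vertices; [i + 1] is computed modulo
   n + 3. *)
Definition is_diagonal (d : {set 'I_n.+3}) : Prop :=
  exists i j : 'I_n.+3,
    [/\ d = [set i; j]%SET, i != j, j != i + 1 & i != j + 1].

Definition diagonal_interior (p : 'I_n.+3 -> 'rV[R]_2) (d : {set 'I_n.+3}) :
    set 'rV[R]_2 :=
  [set x | exists i j : 'I_n.+3, exists t : R,
    [/\ d = [set i; j]%SET, 0 < t, t < 1 & x = (1 - t) *: p i + t *: p j]].

Definition crosses (p : 'I_n.+3 -> 'rV[R]_2) (d e : {set 'I_n.+3}) : Prop :=
  exists x, diagonal_interior p d x /\ diagonal_interior p e x.

(* The literal definition makes a diagonal cross itself, whence [d != e]. *)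
Definition triangulation (p : 'I_n.+3 -> 'rV[R]_2)
    (T : {set {set 'I_n.+3}}) : Prop :=
  [/\ forall d, d \in T -> is_diagonal d, #|T| = n &
      forall d e, d \in T -> e \in T -> d != e -> ~ crosses p d e].

(* The 2(n+3) elements of the dihedral group acting on the vertex labels
   Z/(n+3). *)
Definition dihedral (s : 'I_n.+3 -> 'I_n.+3) : Prop :=
  exists k : 'I_n.+3, (forall i, s i = i + k) \/ (forall i, s i = k - i).

Definition dihedral_equivalent (T1 T2 : {set {set 'I_n.+3}}) : Prop :=
  exists s : 'I_n.+3 -> 'I_n.+3,
    dihedral s /\ T2 = [set s @: d | d : {set 'I_n.+3} in T1]%SET.

End Polygon.

Section Fans.
Variable R : realType.

Definition dual (V : vectType R) : vectType R := 'Hom(V, R^o).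

Definition cone_face (V : vectType R) (C : set V) : set (set V) :=
  [set G | exists phi : dual V, (forall x, C x -> 0 <= phi x) /\
                                G = [set x | C x /\ phi x = 0]].

Definition linearly_isomorphic (V V' : vectType R) (F : set (set V))
    (F' : set (set V')) : Prop :=
  exists f : 'Hom(V, V'), bijective f /\ forall C, F C -> F' (f @` C).

Definition convex_hull (W : vectType R) (s : seq W) : set W :=
  [set x | exists c : 'I_(size s) -> R,
    [/\ forall i, 0 <= c i, \sum_i c i = 1 & x = \sum_i c i *: s`_i]].

Definition polytope (W : vectType R) (P : set W) : Prop :=
  exists s : seq W, s != [::] /\ P = convex_hull s.

(* Polytopes live in the dual of [V], so that their normal fans live in [V]:
   the vector [v] is identified with the linear functional [x |-> x v]. *)
Definition polytope_face (V : vectType R) (P : set (dual V)) (v : V) :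
    set (dual V) :=
  [set x | P x /\ forall y, P y -> y v <= x v].

Definition normal_cone (V : vectType R) (P F : set (dual V)) : set V :=
  [set v | F `<=` polytope_face P v].

Definition normal_fan (V : vectType R) (P : set (dual V)) : set (set V) :=
  [set normal_cone P (polytope_face P v) | v in [set: V]].

Definition normally_isomorphic (V V' : vectType R) (P : set (dual V))
    (P' : set (dual V')) : Prop :=
  linearly_isomorphic (normal_fan P) (normal_fan P').

End Fans.

Section Santos.
Variables (R : realType) (n : nat) (p : 'I_n.+3 -> 'rV[R]_2) (V : vectType R).

Section Seed.
Variables (alpha : n.-tuple V) (delta : n.-tuple {set 'I_n.+3}).

Definition santos_vector (d : {set 'I_n.+3}) : V :=
  if [pick i | tnth delta i == d] is Some i then - tnth alpha i
  else \sum_(i < n | `[< crosses p d (tnth delta i) >]) tnth alpha i.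

Definition santos_cone (T : {set {set 'I_n.+3}}) : set V :=
  [set x | exists c : {set 'I_n.+3} -> R,
    (forall d, 0 <= c d) /\ x = \sum_(d in T) c d *: santos_vector d].

(* A fan consists of the faces of its maximal cones. *)
Definition santos_fan : set (set V) :=
  [set G | exists T, triangulation p T /\ cone_face (santos_cone T) G].

End Seed.

Definition santos_associahedron (T0 : {set {set 'I_n.+3}}) (P : set (dual V)) :
    Prop :=
  exists (alpha : n.-tuple V) (delta : n.-tuple {set 'I_n.+3}),
    [/\ basis_of fullv alpha, T0 =i delta, polytope P &
        normal_fan P = santos_fan alpha delta].

End Santos.

(* Main.v *)
(* Everything is read off two features of the fan: it is complete, and the
   intersection property of normal fans forces each ray of a vector v_d to be
   a cone of the fan lying only on the cones of triangulations containing d.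
   A linear isomorphism of fans therefore permutes the diagonals and preserves
   crossings; for n >= 2 such a permutation permutes the ears {i, i+2}, whose
   crossing graph is an (n+3)-cycle, and is induced by a dihedral symmetry s.
   Flips exist because +alpha_i must lie in some cone, so the isomorphism maps
   alpha_i to a multiple of some beta_j, with a negative factor when s delta_i
   is not in T2.  As some diagonal crosses delta_i together with another
   element of T1, a negative factor would give v_(s e) two nonzero coordinates,
   one of them negative, which no v_d has; hence s T1 = T2. *)
From HB Require Import structures.
Require Import Defs.
From mathcomp Require Import all_boot all_order all_algebra zify ring lra.
From mathcomp Require Import boolp classical_sets reals.
From mathcomp Require Import fintype finset.

Set Implicit Arguments.
Unset Strict Implicit.
Unset Printing Implicit Defensive.

Import Order.TTheory GRing.Theory Num.Theory.

(** * Crossing diagonals of a labelled polygon *)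

(** The fans are given as normal fans of polytopes, so completeness and the intersection of cones
    come from maximizing linear functionals, not from the combinatorics. What needs a construction
    is that every v_d spans a cone of the fan. Faces are cut out by functionals, so for d outside
    the seed one wants a triangulation containing d and a functional that vanishes on v_d and is
    positive on its other vectors. Diagonals issued from one end of d serve for this: the crossed
    seed diagonals nearest to the two ends of d then tell d apart from the rest. The combinatorics
    lives on labels, where crossing means that endpoints interleave; convexity enters only to
    identify this with geometric crossing. Triangle and square are treated apart because opposite
    vertices of a square are cut off by the same diagonal. *)

Definition chord_cross (a b c d : nat) : bool :=
  ((minn a b < minn c d < maxn a b) && (maxn a b < maxn c d)) ||
  ((minn c d < minn a b < maxn c d) && (maxn c d < maxn a b)).

Lemma chord_crossC a b c d : chord_cross a b c d = chord_cross c d a b.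
Proof. by rewrite /chord_cross orbC. Qed.

Lemma chord_crossCl a b c d : chord_cross a b c d = chord_cross b a c d.
Proof. by rewrite /chord_cross minnC maxnC. Qed.

Lemma chord_crossCr a b c d : chord_cross a b c d = chord_cross a b d c.
Proof. by rewrite /chord_cross (minnC c) (maxnC c). Qed.

Lemma chord_crossE a b c d : a <= b -> c <= d ->
  chord_cross a b c d = (a < c < b) && (b < d) || (c < a < d) && (d < b).
Proof.
by move=> /[dup]/minn_idPl e1 /maxn_idPr e2 /[dup]/minn_idPl e3 /maxn_idPr e4;
   rewrite /chord_cross e1 e2 e3 e4.
Qed.

Ltac order_ends a b := let ab := fresh "le" in
  have [ab|/ltnW ab] := leqP a b;
  [rewrite ?(chord_crossCl b a) ?(chord_crossCr _ _ b a)
  |rewrite ?(chord_crossCl a b) ?(chord_crossCr _ _ a b)].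

Ltac chord_lia :=
  repeat match goal with
  | H1 : is_true (?a <= ?b), H2 : is_true (?c <= ?d) |- context [chord_cross ?a ?b ?c ?d] =>
      rewrite (chord_crossE H1 H2)
  end; lia.

(** A chord that enters the triangle [pab] through the side [ab] leaves it through another side or
    at the apex [p]. *)
Lemma chord_triangle a b p q r s : chord_cross a b p q -> chord_cross a b r s ->
  ~~ chord_cross r s p a -> ~~ chord_cross r s p b -> (r == p) || (s == p).
Proof.
by order_ends a b; order_ends p q; order_ends r s; order_ends p a;
   order_ends p b; chord_lia.
Qed.

(** Through [pu] the chord [xy] enters the triangle bounded by [pu], [uv] and [pq]; barred from
    [uv], it leaves through [pq]. *)
Lemma chord_cut x y u v p q :
  chord_cross u v p q -> chord_cross x y p u -> ~~ chord_cross x y u v ->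
  chord_cross x y p q.
Proof. by order_ends x y; order_ends u v; order_ends p q; order_ends p u; chord_lia. Qed.

(** Neither [a] nor [b] is cut off from [p] by [uv], so a chord from [p] meets [ab] before it can
    reach [uv]. *)
Lemma chord_fan a b u v p q r :
  chord_cross a b p q -> chord_cross u v p q -> chord_cross u v p r ->
  ~~ chord_cross u v p a -> ~~ chord_cross u v p b -> chord_cross a b p r.
Proof.
by order_ends a b; order_ends u v; order_ends p q; order_ends p r; order_ends p a;
   order_ends p b; chord_lia.
Qed.

(** As [uv] cuts [a] off from [p] without crossing [ab], it runs between [p] and [ab] and cuts off
    all that [ab] does. *)
Lemma chord_nested a b u v p q r :
  chord_cross u v p q -> chord_cross a b p q -> ~~ chord_cross u v a b ->
  chord_cross u v p a -> chord_cross a b p r -> chord_cross u v p r.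
Proof.
by order_ends a b; order_ends u v; order_ends p q; order_ends p r; order_ends p a; chord_lia.
Qed.

Section Diagonals.
Variable n : nat.
Implicit Types (d e : {set 'I_n.+3}) (a b c : 'I_n.+3) (S T : {set {set 'I_n.+3}}).

Lemma set2_eq (X : finType) (a b c f : X) : [set a; b] = [set c; f] ->
  (a = c /\ b = f) \/ (a = f /\ b = c).
Proof.
move=> E; have := set22 a b; have := set21 a b; rewrite E.
have := set22 c f; have := set21 c f; rewrite -{1 2}E.
by move=> /set2P[]? /set2P[]? /set2P[]? /set2P[]?; subst; auto.
Qed.

(* Crossing in terms of the labels only; it agrees with [crosses] on distinct
   diagonals of a convex polygon, but a diagonal does not cross itself. *)
Definition ccross d e : bool := [exists a, exists b, exists c, exists f,
  [&& d == [set a; b], e == [set c; f] & chord_cross a b c f]].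

Lemma ccrossE a b c f : ccross [set a; b] [set c; f] = chord_cross a b c f.
Proof.
apply/idP/idP => [/existsP[a' /existsP[b' /existsP[c' /existsP[f']]]]|H].
  by case/and3P=> /eqP/set2_eq[[-> ->]|[-> ->]] /eqP/set2_eq[[-> ->]|[-> ->]];
     rewrite // ?(chord_crossCl b') ?(chord_crossCr _ _ f').
by apply/existsP; exists a; apply/existsP; exists b; apply/existsP; exists c;
   apply/existsP; exists f; rewrite !eqxx.
Qed.

Lemma ccross_ex d e : ccross d e ->
  exists a b c f, [/\ d = [set a; b], e = [set c; f] & chord_cross a b c f].
Proof.
case/existsP=> a /existsP[b /existsP[c /existsP[f /and3P[/eqP-> /eqP-> ?]]]].
by exists a, b, c, f.
Qed.

Lemma ccrossC d e : ccross d e = ccross e d.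
Proof.
by apply/idP/idP => /ccross_ex[a [b [c [f [-> -> H]]]]]; rewrite ccrossE chord_crossC.
Qed.

Lemma ccross_irr d : ~~ ccross d d.
Proof.
by apply/negP=> /ccross_ex[a [b [c [f [-> /set2_eq[[-> ->]|[-> ->]]]]]]]; rewrite /chord_cross; lia.
Qed.

Lemma ccross_share p d e : p \in d -> p \in e -> ~~ ccross d e.
Proof.
move=> pd pe; apply/negP => /ccross_ex[a [b [c [f [dE eE]]]]].
by move: pd pe; rewrite dE eE => /set2P[]-> /set2P[]->; rewrite /chord_cross; lia.
Qed.

(** The last condition excludes the side joining the last vertex to [0]. *)
Definition diag d : bool := [exists a, exists b,
  [&& d == [set a; b], a.+1 < b & (0 < a) || (b < n.+2)]].

Lemma diag_ex d : diag d ->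
  exists a b, [/\ d = [set a; b], a.+1 < b & (0 < a) || (b < n.+2)].
Proof.
by case/existsP=> a /existsP[b /and3P[/eqP]]; exists a, b.
Qed.

Lemma diag_intro a b : a.+1 < b -> (0 < a) || (b < n.+2) -> diag [set a; b].
Proof.
by move=> h1 h2; apply/existsP; exists a; apply/existsP; exists b; rewrite eqxx h1.
Qed.

Lemma ccross_diag d e : ccross d e -> diag d.
Proof.
move=> /ccross_ex[a [b [c [f [-> _]]]]] H.
have := (ltn_ord a, ltn_ord b, ltn_ord c, ltn_ord f) => -[[[]]].
wlog ab : a b H / (a : nat) <= b.
  move=> W; case/orP: (leq_total a b) => ab; first exact: W.
  by move=> *; rewrite setUC; apply: W; rewrite 1?chord_crossCl.
by move: H; rewrite /chord_cross => *; apply: diag_intro; lia.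
Qed.

Lemma diag_mem d p : diag d -> p \in d -> exists q, d = [set p; q].
Proof.
move=> /diag_ex[a [b [-> _ _]]] /set2P[->|->]; [by exists b|by exists a; rewrite setUC].
Qed.

Lemma diag_mem2 d p q : diag d -> p \in d -> q \in d -> p != q -> d = [set p; q].
Proof.
by move=> /diag_mem D /D[x ->] /set2P[->|->]//; rewrite eqxx.
Qed.

(** * Extension of noncrossing sets to triangulations *)

Definition noncrossing S := {in S &, forall d e, ~~ ccross d e}.

(** Chords of the subpolygon on the labels from [i] to [j], its closing edge [ij] included. Counting
    that edge makes the size of a maximal noncrossing set [j - i - 1], also for a degenerate
    subpolygon. *)
Definition within (i j : nat) d : bool := [exists a, exists b,
  [&& d == [set a; b], i <= a, a.+1 < b & b <= j]].

Lemma within_ex i j d : within i j d ->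
  exists a b, [/\ d = [set a; b], i <= a, a.+1 < b & b <= j].
Proof. by case/existsP=> a /existsP[b /and4P[/eqP]]; exists a, b. Qed.

Lemma within_intro i j a b : i <= a -> a.+1 < b -> b <= j -> within i j [set a; b].
Proof.
by move=> h1 h2 h3; apply/existsP; exists a; apply/existsP; exists b; rewrite eqxx h1 h2.
Qed.

Lemma within_widen i j i' j' d : i' <= i -> j <= j' -> within i j d -> within i' j' d.
Proof.
by move=> ii jj /within_ex[a [b [-> ? ? ?]]]; apply: within_intro; lia.
Qed.

Lemma within_noncrossing i j w d e : within i w d -> within w j e -> ~~ ccross d e.
Proof.
move=> /within_ex[a [b [-> ? ? ?]]] /within_ex[c [f [-> ? ? ?]]].
by rewrite ccrossE /chord_cross; lia.
Qed.

Lemma within_disjoint i j w d : within i w d -> within w j d -> False.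
Proof.
move=> /within_ex[a [b [-> ? ? ?]]].
by move=> /within_ex[c [f [/set2_eq[[? ?]|[? ?]] ? ? ?]]]; subst; lia.
Qed.

(* Split at the last neighbour [w < j] of [i], or at [i + 1] if there is none;
   nothing passes over [w] except possibly [ij] itself. *)
Lemma noncrossing_extend_within k i j S : j = i + k.+1 -> j < n.+3 ->
  {in S, forall d, within i j d} -> noncrossing S ->
  exists S', [/\ S \subset S', {in S', forall d, within i j d}, noncrossing S'
    & #|S'| = k].
Proof.
elim/ltn_ind: k i j S => -[|k] IH i j S -> lt_jn inS ncS.
  exists S; split=> //; apply/eqP; rewrite cards_eq0 -subset0; apply/subsetP => d.
  by case/inS/within_ex=> a [b []]; lia.
set j' := i + k.+2 in lt_jn inS *.
have i_lt : i < n.+3 by lia.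
pose oi := Ordinal i_lt; pose oj := Ordinal lt_jn.
pose Q w := (i < w < j') && ((w == i.+1) ||
  [exists b : 'I_n.+3, (w == b) && ([set oi; b] \in S)]).
have exQ : exists w, Q w by exists i.+1; rewrite /Q eqxx; lia.
have ubQ w : Q w -> w <= j' by rewrite /Q; lia.
case: (ex_maxnP exQ ubQ) => w /andP[w_int Qw] maxw {exQ ubQ}.
have w_lt : w < n.+3 by lia.
pose S1 := [set d in S | within i w d]; pose S2 := [set d in S | within w j' d].
have [|||d|d e|S1' [sub1 in1 nc1 c1]] := IH (w - i.+1) _ i w S1; try lia.
- by rewrite inE => /andP[].
- by rewrite !inE => /andP[dS _] /andP[eS _]; apply: ncS.
have [|||d|d e|S2' [sub2 in2 nc2 c2]] := IH (j' - w.+1) _ w j' S2; try lia.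
- by rewrite inE => /andP[].
- by rewrite !inE => /andP[dS _] /andP[eS _]; apply: ncS.
pose ij := [set oi; oj].
have ij_in : within i j' ij by apply: within_intro => //=; lia.
have nc_ij d : within i j' d -> ~~ ccross ij d.
  by move=> /within_ex[a [b [-> ? ? ?]]]; rewrite ccrossE /chord_cross /=; lia.
exists (ij |: (S1' :|: S2')); split.
- apply/subsetP => d dS; have [a [b [dE ia ab bj]]] := within_ex (inS _ dS).
  have [bw|wb] := leqP b w.
    rewrite !inE (subsetP sub1) ?orbT // inE dS.
    by rewrite dE; apply: within_intro.
  have [wa|aw] := leqP w a.
    rewrite !inE (subsetP sub2) ?orbT // inE dS.
    by rewrite dE; apply: within_intro.
  have [ai|ai] := eqVneq (a : nat) i.
    have aE : a = oi by apply: val_inj.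
    have [bj'|bj'] := eqVneq (b : nat) j'.
      by rewrite dE aE (_ : b = oj) ?setU11 //; apply: val_inj.
    have /maxw : Q b; last by lia.
    apply/andP; split; first lia.
    by apply/orP; right; apply/existsP; exists b; rewrite eqxx -aE -dE.
  case/orP: Qw => [/eqP wi|/existsP[c /andP[/eqP wc cS]]]; first lia.
  by have := ncS _ _ dS cS; rewrite dE ccrossE /chord_cross /=; lia.
- move=> d; rewrite !inE => /or3P[/eqP->//|/in1|/in2]; apply: within_widen; lia.
- have nc12 d e : d \in S1' -> e \in S2' -> ~~ ccross d e.
    by move=> /in1 h /in2; apply: within_noncrossing h.
  have nc3 d : d \in S1' :|: S2' -> ~~ ccross ij d.
    by rewrite inE => /orP[/in1|/in2] h; apply: nc_ij; apply: within_widen h; lia.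
  have ncU d e : d \in S1' :|: S2' -> e \in S1' :|: S2' -> ~~ ccross d e.
    rewrite !inE => /orP[d1|d2] /orP[e1|e2]; [exact: nc1|exact: nc12| |exact: nc2].
    by rewrite ccrossC nc12.
  move=> d e; rewrite 2!in_setU1 => /orP[/eqP->|d1] /orP[/eqP->|e1].
  + exact: ccross_irr.
  + exact: nc3.
  + by rewrite ccrossC; apply: nc3.
  + exact: ncU.
- have S12 : S1' :&: S2' = set0.
    apply/eqP; rewrite -subset0; apply/subsetP => d; rewrite in_setI => /andP[/in1 h /in2].
    by move/(within_disjoint h).
  have ij1 : ij \notin S1'.
    by apply/negP => /in1/within_ex[a [b [/set2_eq[[]|[]] <- <- /=]]]; lia.
  have ij2 : ij \notin S2'.
    by apply/negP => /in2/within_ex[a [b [/set2_eq[[]|[]] <- <- /=]]]; lia.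
  by rewrite cardsU1 cardsU S12 cards0 in_setU negb_or ij1 ij2; lia.
Qed.

Lemma diag_within d : diag d -> within 0 n.+2 d.
Proof.
by move=> /diag_ex[a [b [-> ? ?]]]; have := ltn_ord b => ?; apply: within_intro.
Qed.

Lemma noncrossing_extend S : {in S, forall d, diag d} -> noncrossing S ->
  exists T, [/\ S \subset T, {in T, forall d, diag d}, noncrossing T & #|T| = n].
Proof.
move=> dS ncS.
(* The closing side of the whole polygon is [within] but not a diagonal. Adding it to [S] forces it
   into the extension of size [n + 1]; removing it leaves [n] diagonals. *)
pose e0 : {set 'I_n.+3} := [set ord0; ord_max].
have nce d : within 0 n.+2 d -> ~~ ccross e0 d.
  by move=> /within_ex[a [b [-> ? ? ?]]]; rewrite ccrossE /chord_cross /=; lia.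
have nd0 : ~~ diag e0.
  apply/negP=> /diag_ex[a [b [/set2_eq[[]|[]] <- <-]]] /=; lia.
have in0 : {in e0 |: S, forall d, within 0 n.+2 d}.
  by move=> d; rewrite in_setU1 => /orP[/eqP->|/dS/diag_within//]; apply: within_intro.
have nc0 : noncrossing (e0 |: S).
  move=> d e; rewrite 2!in_setU1 => /orP[/eqP->|dd] /orP[/eqP->|ee].
  + exact: ccross_irr.
  + exact/nce/diag_within/dS.
  + rewrite ccrossC; exact/nce/diag_within/dS.
  + exact: ncS.
have [T [sT inT ncT cT]] :=
  @noncrossing_extend_within n.+1 0 n.+2 _ (erefl _) (ltnSn _) in0 nc0.
exists (T :\ e0); split.
- apply/subsetP => d dd; rewrite !inE (subsetP sT) ?inE ?dd ?orbT // andbT.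
  by apply: contraNneq nd0 => <-; apply: dS.
- move=> d; rewrite !inE => /andP[de /inT/within_ex[a [b [dE *]]]].
  rewrite dE; apply: diag_intro => //; have := ltn_ord b => ?.
  have [a0|//] := posnP a; have [//|b2] := ltnP b n.+2.
  case/eqP: de; rewrite dE; congr [set _; _]; apply: val_inj => //=; lia.
- by move=> d e; rewrite !inE => /andP[_ dT] /andP[_ eT]; apply: ncT.
- by have := cardsD1 e0 T; rewrite cT (subsetP sT) ?setU11 // add1n => -[<-].
Qed.

Definition ctriangulation T := [/\ {in T, forall d, diag d}, noncrossing T & #|T| = n].

(** Otherwise [d] and [T] would be [n + 1] noncrossing diagonals contained in a set of [n]. *)
Lemma ctriangulation_max T d : ctriangulation T -> diag d -> {in T, forall e, ~~ ccross d e} -> d \in T.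
Proof.
move=> [dT ncT cT] dd ncd; apply: contraT => dNT.
have dT' : {in d |: T, forall e, diag e}.
  by move=> e; rewrite in_setU1 => /orP[/eqP->|/dT].
have ncT' : noncrossing (d |: T).
  move=> e f; rewrite 2!in_setU1 => /orP[/eqP->|ee] /orP[/eqP->|ff].
  - exact: ccross_irr.
  - exact: ncd.
  - by rewrite ccrossC; apply: ncd.
  - exact: ncT.
have [T' [sT _ _ cT']] := noncrossing_extend dT' ncT'.
by have := subset_leq_card sT; rewrite cardsU1 dNT cT cT'; lia.
Qed.

End Diagonals.

(** * Diagonals relative to a seed triangulation *)

Section Seed.
Variables (n : nat) (T0 : {set {set 'I_n.+3}}).
Hypothesis hT0 : ctriangulation T0.
Implicit Types (d e : {set 'I_n.+3}) (a b c p q : 'I_n.+3) (S T : {set {set 'I_n.+3}}).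

(** For diagonals outside the seed this is inclusion of the supports of their vectors. *)
Definition crossed_sub d e := {in T0, forall f, ccross d f -> ccross e f}.

Lemma ctriangulation_crossed d : diag d -> d \notin T0 -> exists2 e, e \in T0 & ccross d e.
Proof.
move=> dd; case: (pickP [pred e in T0 | ccross d e]) => [e /andP[]|H]; first by exists e.
by case/negP; apply: (ctriangulation_max hT0) => // e eT; have /= := H e; rewrite eT /= => ->.
Qed.

Lemma crossed_sub_end u v p q : [set u; v] \in T0 -> chord_cross u v p q ->
  crossed_sub [set p; u] [set p; q].
Proof.
case: hT0 => dT0 ncT0 _ uvT pq e eT; have [x [y [eE _ _]]] := diag_ex (dT0 _ eT).
have := ncT0 _ _ eT uvT; rewrite eE !ccrossE !(chord_crossC _ _ x) => xyuv xypu.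
exact: chord_cut xyuv.
Qed.

(* The first crossed diagonal maximizes the set of vertices cut off from [p]. *)
Lemma first_crossed p q : diag [set p; q] -> [set p; q] \notin T0 ->
  exists a b, [/\ [set a; b] \in T0, chord_cross a b p q,
    {in T0, forall f, ~~ ccross [set p; a] f} &
    {in T0, forall f, ~~ ccross [set p; b] f}].
Proof.
case: (hT0) => dT0 ncT0 _ dpq pqN; have [e0 e0T pqe0] := ctriangulation_crossed dpq pqN.
pose cut e := [set r | ccross e [set p; r]].
case: (@arg_maxnP _ e0 (fun e => (e \in T0) && ccross [set p; q] e) (fun e => #|cut e|)).
  by rewrite e0T pqe0.
move=> e /andP[eT pqe] maxe.
have key a b : e = [set a; b] -> {in T0, forall f, ~~ ccross [set p; a] f}.
  move=> eE f fT; apply/negP => paf.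
  have abpq : chord_cross a b p q by rewrite chord_crossC -ccrossE -eE.
  have fpq : ccross [set p; q] f.
    by apply: (@crossed_sub_end a b p q) => //; rewrite -eE.
  have /maxe : (f \in T0) && ccross [set p; q] f by rewrite fT.
  (* [f] cuts off from [p] every vertex that [e] does, and also [a], an endpoint of [e]: this
     contradicts maximality. *)
  rewrite /= leqNgt => /negP[]; apply/proper_card/properP; split.
    apply/subsetP => r; rewrite !inE.
    have [u [v [fE _ _]]] := diag_ex (dT0 _ fT).
    rewrite eE fE !ccrossE; apply: chord_nested abpq _ _.
    - by rewrite chord_crossC -ccrossE -fE.
    - by rewrite -!ccrossE -fE -eE ncT0.
    - by rewrite chord_crossC -ccrossE -fE.
  exists a; rewrite !inE; first by rewrite ccrossC.
  by apply: (@ccross_share _ a); rewrite ?eE !inE eqxx ?orbT.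
have [a [b [eE _ _]]] := diag_ex (dT0 _ eT).
exists a, b; split; [by rewrite -eE|by rewrite chord_crossC -ccrossE -eE|exact: key eE|].
by apply: (key b a); rewrite setUC.
Qed.

(** If [e] crossed [pa], that diagonal, uncrossed by the seed, would belong to it, and [pq] would
    have to cross it although they share [p]. The same goes for [pb], so [e] leaves the triangle
    [pab] at [p]. *)
Lemma crossed_sub_mem a b p q e : [set a; b] \in T0 -> chord_cross a b p q ->
  {in T0, forall f, ~~ ccross [set p; a] f} ->
  {in T0, forall f, ~~ ccross [set p; b] f} ->
  crossed_sub e [set p; q] -> ccross e [set a; b] -> p \in e.
Proof.
move=> abT abpq pa pb epq eab; have [r [s [x [y [eE /set2_eq xyE _]]]]] := ccross_ex eab.
have key c : {in T0, forall f, ~~ ccross [set p; c] f} -> ~~ chord_cross r s p c.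
  move=> pc; rewrite -ccrossE -eE; apply/negP => epc.
  have pcT : [set p; c] \in T0.
    by apply: (ctriangulation_max hT0) => //; rewrite ccrossC in epc; apply: ccross_diag epc.
  by have /epq/(_ epc) := pcT; apply/negP/(@ccross_share _ p); rewrite !inE eqxx.
have : chord_cross a b r s by rewrite chord_crossC -ccrossE -eE.
move/(chord_triangle abpq)/(_ (key _ pa))/(_ (key _ pb)).
by rewrite eE !inE => /orP[] /eqP/val_inj->; rewrite eqxx ?orbT.
Qed.

(** [crossed_sub_mem], applied from each end of [d], puts both ends of [d] in [e]. *)
Lemma crossed_sub_eq d e : diag d -> d \notin T0 -> diag e -> e \notin T0 ->
  {in T0, forall f, ccross d f = ccross e f} -> d = e.
Proof.
move=> dd dN de eN H; have [p [q [dE pq _]]] := diag_ex dd.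
have npq : p != q by apply: contraTneq pq => ->; lia.
have sub : crossed_sub e d by move=> f fT; rewrite H.
have key r s : d = [set r; s] -> r \in e.
  move=> dE'; rewrite dE' in dd dN.
  have [a [b [abT abrs ra rb]]] := first_crossed dd dN.
  apply: (crossed_sub_mem abT abrs) => //; first by rewrite -dE'.
  by rewrite -H // dE' ccrossE chord_crossC.
have qe : q \in e by apply: (key q p); rewrite setUC.
by rewrite dE (diag_mem2 de (key p q dE) qe npq).
Qed.

(* [T] consists of the seed diagonals not crossed by [d] together with
   diagonals issued from an endpoint of [d]. *)
Lemma ray_triangulation d : diag d -> d \notin T0 -> exists T f g,
  [/\ ctriangulation T, d \in T, [/\ f \in T0, g \in T0, ccross d f & ccross d g],
    {in T, forall e, e \in T0 -> ~~ ccross d e} &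
    {in T, forall e, e \notin T0 ->
       [/\ crossed_sub e d, ccross e f & ccross e g -> e = d]}].
Proof.
case: (hT0) => dT0 ncT0 _ dd dN; have [p [q [dE pq _]]] := diag_ex dd.
have npq : p != q by apply: contraTneq pq => ->; lia.
have pd : p \in d by rewrite dE set21.
have qd : q \in d by rewrite dE set22.
have [a [b [abT abpq pa pb]]] : exists a b, [/\ [set a; b] \in T0, chord_cross a b p q,
    {in T0, forall f, ~~ ccross [set p; a] f} &
    {in T0, forall f, ~~ ccross [set p; b] f}].
  by apply: first_crossed; rewrite -?dE.
have [a' [b' [abT' abqp' qa qb]]] : exists a b, [/\ [set a; b] \in T0, chord_cross a b q p,
    {in T0, forall f, ~~ ccross [set q; a] f} &
    {in T0, forall f, ~~ ccross [set q; b] f}].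
  by apply: first_crossed; rewrite setUC -?dE.
pose B := [set e in T0 | ~~ ccross d e] :|:
  [set e | [&& diag e, p \in e, e \notin T0 &
            [forall f in T0, ccross e f ==> ccross d f]]].
have BP e : e \in B -> (e \in T0 /\ ~~ ccross d e) \/
    [/\ diag e, p \in e, e \notin T0 & crossed_sub e d].
  rewrite !inE => /orP[/andP[]|/and4P[? ? ? /forall_inP H]]; first by left.
  by right; split=> // f /H/implyP.
have BI e : diag e -> p \in e -> crossed_sub e d -> e \in B.
  move=> de pe ed; rewrite !inE de pe /=; case: (boolP (e \in T0)) => eT /=.
    by rewrite (ccross_share pd pe).
  by apply/forall_inP => f /ed H; apply/implyP.
have dB : {in B, forall e, diag e}.
  by move=> e /BP[[/dT0]|[]].
have ncB : noncrossing B.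
  have nc12 e f : e \in T0 -> ~~ ccross d e -> crossed_sub f d -> ~~ ccross f e.
    by move=> eT de fd; apply: contra de; apply: fd.
  move=> e f /BP[[e1 e2]|[e1 e2 e3 e4]] /BP[[f1 f2]|[f1 f2 f3 f4]].
  - exact: ncT0.
  - by rewrite ccrossC nc12.
  - by rewrite nc12.
  - exact: ccross_share e2 f2.
(* [B] is not counted: it is completed arbitrarily, and every diagonal of the completion then turns
   out to have the required form. *)
have [T [sT dT ncT cT]] := noncrossing_extend dB ncB.
have dInB : d \in B by apply: BI.
have dInT : d \in T by apply: (subsetP sT).
have subT e : e \in T -> crossed_sub e d.
  move=> eT f fT ef; apply: contraT => df.
  have fInT : f \in T by apply: (subsetP sT); rewrite !inE fT df.
  by have := ncT _ _ eT fInT; rewrite ef.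
have pT e : e \in T -> e \notin T0 -> p \in e.
  move=> eT eN; have [f fT ef] := ctriangulation_crossed (dT _ eT) eN.
  have [u [v [fE _ _]]] := diag_ex (dT0 _ fT).
  have [r [s [eE _ _]]] := diag_ex (dT _ eT).
  have uvpq : chord_cross u v p q.
    by have := subT _ eT _ fT ef; rewrite dE fE ccrossE chord_crossC.
  have key x y : f = [set x; y] -> chord_cross x y p q -> ~~ chord_cross r s p x.
    move=> fE' xypq; rewrite -ccrossE -eE; apply/negP => epx.
    suff /(subsetP sT) pxT : [set p; x] \in B by have := ncT _ _ eT pxT; rewrite epx.
    apply: BI; rewrite ?set21 //; first by rewrite ccrossC in epx; apply: ccross_diag epx.
    by rewrite dE; apply: crossed_sub_end xypq; rewrite -fE'.
  have : chord_cross u v r s by rewrite chord_crossC -ccrossE -eE -fE.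
  have pv : ~~ chord_cross r s p v by apply: (key v u); rewrite 1?setUC 1?chord_crossCl.
  move/(chord_triangle uvpq)/(_ (key _ _ fE uvpq) pv).
  by rewrite eE !inE => /orP[] /eqP/val_inj->; rewrite eqxx ?orbT.
(* These are the seed diagonals crossed first by [d] from [p] and from [q]. Every other diagonal of
   [T] outside the seed also starts at [p] and crosses the former; only [d] itself reaches beyond
   the latter. *)
exists T, [set a; b], [set a'; b']; split=> //.
- by split=> //; rewrite dE ccrossE chord_crossC // (chord_crossCr _ _ p).
- by move=> e eT _; apply: ncT.
move=> e eT eN; have pe := pT _ eT eN; split; first exact: subT.
- have [r eE] := diag_mem (dT _ eT) pe.
  have [f fT ef] := ctriangulation_crossed (dT _ eT) eN.
  have [u [v [fE _ _]]] := diag_ex (dT0 _ fT).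
  rewrite eE ccrossE chord_crossC; apply: (@chord_fan a b u v p q r abpq).
  + by have := subT _ eT _ fT ef; rewrite dE fE ccrossE chord_crossC.
  + by rewrite chord_crossC -ccrossE -eE -fE.
  + by rewrite chord_crossC -ccrossE -fE pa.
  + by rewrite chord_crossC -ccrossE -fE pb.
- move=> eab; rewrite dE; apply: (diag_mem2 (dT _ eT) pe) => //.
  apply: (crossed_sub_mem abT' abqp' qa qb _ eab).
  by rewrite setUC -dE; apply: subT.
Qed.

End Seed.

(** * Diagonals crossing two given ones *)

Section Crossers.
Variable n : nat.
Implicit Types (d e : {set 'I_n.+3}).

Lemma common_crosser d e : diag d -> diag e -> d != e -> ~~ ccross d e ->
  exists f, ccross f d && ccross f e.
Proof.
move=> /diag_ex[a [c [-> ac acN]]] /diag_ex[u [w [-> uw uwN]]] ne nc.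
have lts := (ltn_ord a, ltn_ord c, ltn_ord u, ltn_ord w).
have neq : (a != u :> nat) || (c != w :> nat).
  apply: contraNT ne; rewrite negb_or !negbK => /andP[/eqP/val_inj-> /eqP/val_inj->].
  exact: eqxx.
have {}nc : [|| (a <= u) && (w <= c), (u <= a) && (c <= w), c <= u | w <= a].
  by move: nc; rewrite ccrossE chord_crossE; lia.
case: lts => -[[la lc] lu] lw.
(* For nested diagonals, join a vertex cut off by the inner one to a vertex beyond the outer one,
   [0] or [n + 2]; otherwise join the vertices following [a] and [u]. *)
have [x [y [xn yn H]]] : exists x y, [/\ x < n.+3, y < n.+3 &
    chord_cross x y a c && chord_cross x y u w].
  case/or4P: nc => H.
  - have [a0|a0] := posnP a.
      by exists u.+1, n.+2; split; rewrite /chord_cross; lia.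
    by exists u.+1, 0; split; rewrite /chord_cross; lia.
  - have [u0|u0] := posnP u.
      by exists a.+1, n.+2; split; rewrite /chord_cross; lia.
    by exists a.+1, 0; split; rewrite /chord_cross; lia.
  - exists a.+1, u.+1; split; rewrite /chord_cross; lia.
  - exists a.+1, u.+1; split; rewrite /chord_cross; lia.
by exists [set Ordinal xn; Ordinal yn]; rewrite !ccrossE.
Qed.

End Crossers.

(** * Automorphisms of the crossing relation *)

Section Dihedral.
Variable n : nat.
Local Notation I := 'I_n.+3.
Implicit Types (d e : {set I}) (a b c i j k : I).
Local Open Scope ring_scope.

Lemma ord_eqE i j : (i == j) = (i == j :> nat).
Proof. by []. Qed.

Lemma val_succ i : (i + 1 : I) = (if i == n.+2 :> nat then 0 else i.+1)%N :> nat.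
Proof.
have lt := ltn_ord i; rewrite [LHS]/= (modn_small (_ : 1 < n.+3)%N) // addn1.
have [->|ne] := eqVneq (nat_of_ord i) n.+2; first by rewrite modnn.
by rewrite modn_small //; lia.
Qed.

Lemma val_succ2 i : (i + 1 + 1 : I) =
  (if i == n.+2 :> nat then 1 else if i == n.+1 :> nat then 0 else i.+2)%N :> nat.
Proof.
by rewrite !val_succ; case: (nat_of_ord i == n.+2) => //=; rewrite eqSS.
Qed.

Lemma val_opp i : (- i : I) = (if i == 0 :> nat then 0 else n.+3 - i)%N :> nat.
Proof.
have lt := ltn_ord i; rewrite [LHS]/=.
have [->|ne] := eqVneq (nat_of_ord i) 0%N; first by rewrite subn0 modnn.
by rewrite modn_small //; lia.
Qed.

Lemma diagP d : is_diagonal d <-> diag d.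
Proof.
split=> [[i [j [-> ij ij1 ji1]]]|/diag_ex[i [j [-> ij ij0]]]].
- have lts := (ltn_ord i, ltn_ord j).
  move: ij ij1 ji1; rewrite !ord_eqE !val_succ.
  case: lts => li lj.
  by have [lt|lt] := ltnP i j; [|rewrite setUC]; do ?[case: ifP => ?] => *;
    apply: diag_intro; lia.
- exists i, j; have [lti ltj] := (ltn_ord i, ltn_ord j).
  rewrite !ord_eqE !val_succ; by split=> //; do ?[case: ifP => ?]; lia.
Qed.

Lemma diag_crosser d : diag d -> exists e, ccross d e.
Proof.
move=> /diag_ex[a [b [-> ab abN]]]; have [la lb] := (ltn_ord a, ltn_ord b).
have [y yn] : exists y : nat, (y < n.+3)%N && chord_cross a b a.+1 y.
  by have [a0|a0] := posnP a; [exists n.+2|exists 0%N]; rewrite /chord_cross; lia.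
have [yn' abxy] := andP yn; have xn : (a.+1 < n.+3)%N by lia.
by exists [set Ordinal xn; Ordinal yn']; rewrite ccrossE.
Qed.

Lemma imset_set2 (X Y : finType) (s : X -> Y) x y : s @: [set x; y] = [set s x; s y].
Proof. by rewrite imsetU !imset_set1. Qed.

Lemma dihedral_chord_cross s a b c i : dihedral s ->
  chord_cross (s a) (s b) (s c) (s i) = chord_cross a b c i.
Proof.
have rot1 a' b' c' i' :
      chord_cross (a' + 1 : I)%R (b' + 1 : I)%R
        (c' + 1 : I)%R (i' + 1 : I)%R =
      chord_cross a' b' c' i'.
  have [la lb] := (ltn_ord a', ltn_ord b'); have [lc li] := (ltn_ord c', ltn_ord i').
  rewrite !val_succ; do ?[case: ifP => ?]; rewrite /chord_cross; lia.
have rot k a' b' c' i' :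
      chord_cross (a' + k : I)%R (b' + k : I)%R
        (c' + k : I)%R (i' + k : I)%R =
      chord_cross a' b' c' i'.
  rewrite -(natr_Zp k); elim: (val k) => [|m IH]; first by rewrite !addr0.
  by rewrite mulrSr !addrA rot1.
have refl a' b' c' i' :
      chord_cross (- a' : I)%R (- b' : I)%R (- c' : I)%R (- i' : I)%R =
      chord_cross a' b' c' i'.
  have [la lb] := (ltn_ord a', ltn_ord b'); have [lc li] := (ltn_ord c', ltn_ord i').
  rewrite !val_opp; do ?[case: ifP => ?]; rewrite /chord_cross; lia.
case=> k [] sE; rewrite !sE ?rot // !(addrC k) rot; exact: refl.
Qed.

Lemma dihedral_inj s : @dihedral n s -> injective s.
Proof. by case=> k [] sE i j; rewrite !sE; [move/addIr|move/addrI/oppr_inj]. Qed.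

Lemma dihedral_inv s : @dihedral n s -> exists t, dihedral t /\ cancel t s.
Proof.
case=> k [] sE.
- by exists (fun i => i + - k); split; [exists (- k); left|move=> i; rewrite sE subrK].
- by exists s; split; [exists k; right|move=> i; rewrite !sE subKr].
Qed.

Lemma dihedral_ccross s d e : dihedral s -> ccross d e -> ccross (s @: d) (s @: e).
Proof.
by move=> hs /ccross_ex[a [b [c [f [-> -> H]]]]]; rewrite !imset_set2 ccrossE dihedral_chord_cross.
Qed.

Lemma dihedral_ccrossE s d e : dihedral s -> ccross (s @: d) (s @: e) = ccross d e.
Proof.
move=> hs; apply/idP/idP; last exact: dihedral_ccross.
have [t [ht ts]] := dihedral_inv hs.
have st : cancel s t by move=> i; apply: (dihedral_inj hs); rewrite ts.
by move/(dihedral_ccross ht); rewrite -!imset_comp !(eq_imset _ st) !imset_id.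
Qed.

Lemma dihedral_diag s d : dihedral s -> diag d -> diag (s @: d).
Proof.
by move=> hs /diag_crosser[e /(dihedral_ccross hs)/ccross_diag].
Qed.

Lemma dihedral_ctriangulation s T : dihedral s -> ctriangulation T ->
  ctriangulation [set s @: d | d : {set I} in T]%SET.
Proof.
move=> hs [dT ncT cT]; split.
- by move=> _ /imsetP[d /dT dd ->]; apply: dihedral_diag.
- move=> _ _ /imsetP[d dd ->] /imsetP[e ee ->]; rewrite dihedral_ccrossE //; exact: ncT.
- by rewrite card_imset //; apply/imset_inj/dihedral_inj.
Qed.

(** The ear [i] cuts off the vertex [i + 1], which explains the shifts by one below. *)
Definition ear i : {set I} := [set i; i + 1 + 1].

Lemma ear_diag i : (0 < n)%N -> diag (ear i).
Proof.
move=> n0; have li := ltn_ord i; rewrite /ear; set j : I := i + 1 + 1.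
have jE := val_succ2 i : nat_of_ord j = _.
have [le|le] := leqP i j; [|rewrite setUC]; apply: diag_intro;
  move: jE le; do ?[case: ifP => ?]; lia.
Qed.

Lemma ccross_ear d i : diag d -> ccross d (ear i) = (i + 1 \in d).
Proof.
move=> /diag_ex[a [b [-> ab abN]]].
rewrite ccrossE !inE !ord_eqE /chord_cross.
have [la lb] := (ltn_ord a, ltn_ord b); have li := ltn_ord i.
by rewrite ?val_succ2 ?val_succ; do ?[case: ifP => ?]; lia.
Qed.

(** Ears are thus described by crossings alone, so automorphisms of the crossing relation permute
    them. If both sides of [ab] contain two vertices, joining [a + 1] to [b + 1] and [a + 2] to
    [b + 2] gives diagonals crossing [ab] and each other. *)
Lemma ear_char d : diag d -> (forall e f, ccross e d -> ccross f d -> ~~ ccross e f) ->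
  exists i, d = ear i.
Proof.
move=> /diag_ex[a [b [-> ab abN]]] H; have [la lb] := (ltn_ord a, ltn_ord b).
have [b2|b2] := eqVneq (b : nat) a.+2.
  exists a; congr [set _; _]; apply/eqP; rewrite ord_eqE val_succ2.
  by do ?[case: ifP => ?]; lia.
have [b3|b3] := eqVneq (b : nat) (a + n.+1)%N.
  exists b; rewrite setUC; congr [set _; _]; apply/eqP.
  by rewrite ord_eqE val_succ2; do ?[case: ifP => ?]; lia.
pose v1 := (b + 1 : I); pose v2 := (b + 1 + 1 : I).
have x1 : (a.+1 < n.+3)%N by lia.
have x2 : (a.+2 < n.+3)%N by lia.
have E1 : ccross [set Ordinal x1; v1] [set a; b].
  by rewrite ccrossE /chord_cross val_succ [nat_of_ord (Ordinal _)]/=; case: ifP => ?; lia.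
have E2 : ccross [set Ordinal x2; v2] [set a; b].
  rewrite ccrossE /chord_cross ?val_succ2 ?val_succ [nat_of_ord (Ordinal _)]/=.
  by do ?[case: ifP => ?]; lia.
have := H _ _ E1 E2.
by rewrite ccrossE /chord_cross ?val_succ2 ?val_succ /=; do ?[case: ifP => ?]; lia.
Qed.

(** In a square, opposite vertices have the same ear, whence [1 < n]. *)
Lemma ear_inj : (1 < n)%N -> injective ear.
Proof.
move=> n1 i j /set2_eq[[]//|[ij ji]].
move: (congr1 (@nat_of_ord _) ij) (congr1 (@nat_of_ord _) ji).
have [li lj] := (ltn_ord i, ltn_ord j).
by rewrite !val_succ2; do ?[case: ifP => ?]; lia.
Qed.

Lemma cycle_automorphism (g : I -> I) : injective g ->
  (forall i, g (i + 1) = g i + 1 \/ g (i + 1) = g i - 1) ->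
  (forall i, g i = i + g 0) \/ (forall i, g i = g 0 - i).
Proof.
move=> ginj gS.
have ne2 i : i + 1 + 1 != i.
  have li := ltn_ord i; rewrite ord_eqE ?val_succ2 ?val_succ.
  by do ?[case: ifP => ?]; lia.
have step u : g (0 + 1) = g 0 + u ->
    (forall i, g (i + 1) = g i + u \/ g (i + 1) = g i - u) ->
    forall k : nat, g k%:R = g 0 + u *+ k /\ g (k%:R + 1) = g 0 + u *+ k + u.
  move=> g1 gu; elim=> [|k [gk gk1]]; first by rewrite mulr0n addr0 -g1.
  split; rewrite !mulrSr addrA //.
  (* Turning back would repeat the value taken two steps earlier, against injectivity. *)
  case: (gu (k%:R + 1)) => E; first by rewrite E gk1.
  by move: E; rewrite gk1 -gk addrK => /ginj/eqP; rewrite (negPf (ne2 _)).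
case: (gS 0) => g1.
- left=> i; rewrite -{1}(natr_Zp i); have [|-> _] := step 1 g1 _ i; first exact: gS.
  by rewrite natr_Zp addrC.
- right=> i; rewrite -{1}(natr_Zp i); have [|-> _] := step (-1) g1 _ i.
    by move=> j; rewrite opprK; case: (gS j); [right|left].
  by rewrite mulNrn natr_Zp.
Qed.

(* Pigeonhole: [phi] permutes the finite set of noncrossing pairs. *)
Lemma noncrossing_automorphism (phi : {set I} -> {set I}) :
  {in @diag n, forall d, diag (phi d)} -> {in @diag n &, injective phi} ->
  {in @diag n &, forall d e, ~~ ccross d e -> ~~ ccross (phi d) (phi e)} ->
  {in @diag n &, forall d e, ccross (phi d) (phi e) = ccross d e} /\
  {in @diag n, forall e, exists2 d, diag d & e = phi d}.
Proof.
move=> phiD phiI phiN; pose D := [set d | @diag n d]%SET.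
have DE d : (d \in D) = diag d by rewrite inE.
split.
- move=> d e dd de; apply/idP/idP => [|de'].
    by apply: contraTT; apply: phiN.
  pose N := [set x in finset.setX D D | ~~ ccross x.1 x.2]%SET.
  pose phi2 x := (phi x.1, phi x.2).
  have sub : phi2 @: N \subset N.
    apply/subsetP => _ /imsetP[[x y] + ->]; rewrite !inE /= => /andP[/andP[dx dy] xy].
    by rewrite !phiD // phiN.
  have /eqP E : phi2 @: N == N.
    rewrite eqEcard sub card_in_imset ?leqnn //.
    move=> [x y] [x' y']; rewrite !inE /= => /andP[/andP[? ?] _] /andP[/andP[? ?] _].
    by case=> /phiI -> // /phiI ->.
  apply: contraT => nc; have : (phi d, phi e) \in phi2 @: N.
    by rewrite E !inE /= !phiD.
  case/imsetP => [[x y]]; rewrite !inE /= => /andP[/andP[dx dy] xy].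
  by case=> /phiI dE /phiI eE; rewrite -dE // -eE // de' in xy.
- move=> e de; have sub : phi @: D \subset D.
    by apply/subsetP => _ /imsetP[x + ->]; rewrite !DE => /phiD.
  have /eqP E : phi @: D == D.
    by rewrite eqEcard sub card_in_imset ?leqnn // => x y; rewrite !DE; apply: phiI.
  by have : e \in D by [rewrite DE]; rewrite -E => /imsetP[d]; rewrite DE; exists d.
Qed.

Lemma automorphism_dihedral (phi : {set I} -> {set I}) : (1 < n)%N ->
  {in @diag n, forall d, diag (phi d)} -> {in @diag n &, injective phi} ->
  {in @diag n &, forall d e, ~~ ccross d e -> ~~ ccross (phi d) (phi e)} ->
  exists s, dihedral s /\ {in @diag n, forall d, phi d = s @: d}.
Proof.
move=> n1 phiD phiI phiN; have [phiC phiS] := noncrossing_automorphism phiD phiI phiN.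
have dear i : diag (ear i) by apply: ear_diag; lia.
have gP i : exists j, phi (ear i) == ear j.
  have [|e f|j ->] := @ear_char (phi (ear i)); last by exists j.
    by apply: phiD; apply: dear.
  move=> ei fi; have [d dd eE] := phiS _ (ccross_diag ei).
  have [c dc fE] := phiS _ (ccross_diag fi).
  move: ei fi; rewrite eE fE (phiC _ _ dd dc) (phiC _ _ dd (dear i)).
  rewrite (phiC _ _ dc (dear i)) !ccross_ear //; exact: ccross_share.
pose g i := xchoose (gP i).
have gE i : phi (ear i) = ear (g i) by apply/eqP/(xchooseP (gP i)).
have ginj : injective g.
  move=> i j gij; apply: (ear_inj n1); apply: (phiI _ _ (dear i) (dear j)).
  by rewrite !gE gij.
(* A vertex lies on a diagonal exactly when its ear crosses it, so [phi] acts on vertices through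
   its action [g] on ears. *)
have memE d i : diag d -> (g i + 1 \in phi d) = (i + 1 \in d).
  move=> dd; rewrite -(ccross_ear i dd) -(ccross_ear _ (phiD _ dd)) -gE.
  exact: (phiC _ _ dd (dear i)).
have gS i : g (i + 1) = g i + 1 \/ g (i + 1) = g i - 1.
  have := memE (ear i) (i + 1) (dear _); rewrite gE !inE eqxx orbT.
  move=> /orP[/eqP H|/eqP/addIr->]; [right|by left].
  by rewrite -H addrK.
have phi_im s : (forall i, s (i + 1) = g i + 1) -> dihedral s ->
    {in @diag n, forall d, phi d = s @: d}.
  move=> sE hs d dd; have si := dihedral_inj hs; apply/esym/eqP.
  have [a [b [dE ab _]]] := diag_ex dd.
  have [a' [b' [pE ab' _]]] := diag_ex (phiD _ dd).
  rewrite eqEcard; apply/andP; split.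
    apply/subsetP => _ /imsetP[i id ->].
    by rewrite -(subrK 1 i) sE memE // subrK.
  have nab : a != b by apply: contraTneq ab => ->; lia.
  by rewrite card_imset // pE dE !cards2 nab; case: (_ != _).
case: (cycle_automorphism ginj gS) => gE'.
- exists (fun i => i + g 0); have hs : dihedral (fun i => i + g 0) by exists (g 0); left.
  split=> //; apply: phi_im => // i; rewrite (gE' i); exact: addrAC.
(* The constant is forced by [s (i + 1) = g i + 1] with [g i = g 0 - i]. *)
- pose s i : I := (g 0 + 1 + 1) - i; have hs : dihedral s by exists (g 0 + 1 + 1); right.
  exists s; split=> //; apply: phi_im => // i.
  by rewrite /s (gE' i) opprD addrA addrAC addrK addrAC.
Qed.

End Dihedral.

(** * Convex polygons in the plane *)

Section Geometry.
Variable R : realType.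
Local Open Scope ring_scope.
Implicit Types (A B C F : 'rV[R]_2).

Lemma row2P A B : A 0 0 = B 0 0 -> A 0 1 = B 0 1 -> A = B.
Proof.
move=> e0 e1; apply/rowP => j.
have [->|->] // : j = 0 \/ j = 1.
by case: j => [[|[|//]] ?]; [left|right]; apply: val_inj.
Qed.

Lemma orientation_rot A B C : orientation A B C = orientation B C A.
Proof. rewrite /orientation; ring. Qed.

Lemma orientation_flip A B C : orientation A B C = - orientation A C B.
Proof. rewrite /orientation; ring. Qed.

Lemma orientation_comb A B C F (u : R) :
  orientation A B ((1 - u) *: C + u *: F) =
  (1 - u) * orientation A B C + u * orientation A B F.
Proof. rewrite /orientation !mxE; ring. Qed.

Lemma orientation_on A B (t : R) : orientation A B ((1 - t) *: A + t *: B) = 0.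
Proof. rewrite /orientation !mxE; ring. Qed.

Lemma segments_meet A B C F : 0 < orientation A C F -> 0 < orientation C B F ->
  0 < orientation A C B -> 0 < orientation A B F ->
  exists t u : R, [/\ 0 < t < 1, 0 < u < 1 &
    (1 - t) *: A + t *: B = (1 - u) *: C + u *: F].
Proof.
move=> h1 h2 h3 h4; set o1 := orientation A C F in h1; set o2 := orientation C B F in h2.
set o3 := orientation A C B in h3; set o4 := orientation A B F in h4.
have E : o1 + o2 = o3 + o4 by rewrite /o1 /o2 /o3 /o4 /orientation; ring.
have p12 : 0 < o1 + o2 by apply: addr_gt0.
have p34 : 0 < o3 + o4 by apply: addr_gt0.
(* Each diagonal of the quadrilateral [ACBF] is divided in the ratio of the areas of the two
   triangles based on the other; by [E] both sums of areas are that of the quadrilateral, up to the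
   factor 2. *)
exists (o1 / (o1 + o2)), (o3 / (o1 + o2)); split.
- by rewrite divr_gt0 // ltr_pdivrMr // mul1r ltrDl.
- by rewrite divr_gt0 // ltr_pdivrMr // mul1r E ltrDl.
have n12 : o1 + o2 != 0 by rewrite gt_eqF.
apply: (scalerI n12); rewrite !scalerDr !scalerA !mulrBr !mulr1.
rewrite ![_ * (_ / _)]mulrC !divfK //.
by apply: row2P; rewrite !mxE /o1 /o2 /o3 /orientation; ring.
Qed.

Variables (n : nat) (p : 'I_n.+3 -> 'rV[R]_2).
Hypothesis hp : convex_polygon p.
Local Notation I := 'I_n.+3.
Implicit Types (a b c f : I) (d e : {set I}).

Lemma orientation_gt0 a b c : (a < b)%N -> (c < a)%N || (b < c)%N ->
  0 < orientation (p a) (p b) (p c).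
Proof.
move=> ab /orP[ca|bc]; last exact: hp.
by rewrite -orientation_rot; apply: hp.
Qed.

Lemma orientation_lt0 a b c : (a < c < b)%N -> orientation (p a) (p b) (p c) < 0.
Proof.
by case/andP=> ac cb; rewrite orientation_flip oppr_lt0; apply: hp.
Qed.

Lemma orientation_eq0 a b c : (c == a) || (c == b) -> orientation (p a) (p b) (p c) = 0.
Proof. by move=> /orP[]/eqP->; rewrite /orientation; ring. Qed.

Lemma crossesC d e : crosses p d e -> crosses p e d.
Proof. by case=> x [dx ex]; exists x. Qed.

Lemma interior_set2 a b x : diagonal_interior p [set a; b]%SET x ->
  exists2 t : R, 0 < t < 1 & x = (1 - t) *: p a + t *: p b.
Proof.
case=> i [j [t [/set2_eq[[<- <-]|[-> ->]] t0 t1 ->]]].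
  by exists t; rewrite ?t0.
by exists (1 - t); [lra|rewrite subKr addrC].
Qed.

Lemma crosses_ccross d e : diag d -> diag e -> d != e ->
  crosses p d e <-> ccross d e.
Proof.
move=> /diag_ex[a [b [dE ab _]]] /diag_ex[c [f [eE cf _]]] ne; split.
- case=> x [dx ex]; rewrite {}dE in dx ne *; rewrite {}eE in ex ne *.
  have [t t01 xE] := interior_set2 dx; have [u u01 xE'] := interior_set2 ex.
  (* The common point has orientation 0 with respect to [ab]. If the endpoints do not interleave,
     [c] and [f] lie on one closed side of [ab], at least one of them strictly, so a combination
     with positive weights cannot vanish. *)
  have := orientation_on (p a) (p b) t; rewrite -xE xE' orientation_comb.
  apply: contra_eqT => nc; rewrite ccrossE in nc.
  have {}ne : ~~ ((c == a) && (f == b)).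
    by apply: contraNN ne => /andP[/eqP-> /eqP->].
  have pos (g : I) : ~~ (a < g < b)%N -> 0 <= orientation (p a) (p b) (p g).
    move=> h; have [/orientation_eq0->//|] := boolP ((g == a) || (g == b)).
    by rewrite !ord_eqE => ?; apply/ltW/orientation_gt0; lia.
  have neg (g : I) : (a <= g <= b)%N -> orientation (p a) (p b) (p g) <= 0.
    move=> h; have [/orientation_eq0->//|] := boolP ((g == a) || (g == b)).
    by rewrite !ord_eqE => ?; apply/ltW/orientation_lt0; lia.
  have spos (g : I) : (g < a)%N || (b < g)%N -> 0 < orientation (p a) (p b) (p g).
    by apply: orientation_gt0; lia.
  have sneg (g : I) : (a < g < b)%N -> orientation (p a) (p b) (p g) < 0.
    exact: orientation_lt0.
  have {nc} : [|| (a <= c <= b)%N && (a < f < b)%N, (a < c < b)%N && (a <= f <= b)%N,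
      ~~ (a < c < b)%N && ((f < a)%N || (b < f)%N) |
      ((c < a)%N || (b < c)%N) && ~~ (a < f < b)%N].
    move: ne nc; rewrite !ord_eqE chord_crossE; lia.
  case/or4P => /andP[].
  + by move=> /neg h1 /sneg h2; rewrite lt_eqF //; nra.
  + by move=> /sneg h1 /neg h2; rewrite lt_eqF //; nra.
  + by move=> /pos h1 /spos h2; rewrite gt_eqF //; nra.
  + by move=> /spos h1 /pos h2; rewrite gt_eqF //; nra.
- have key a' b' c' f' : (a' < c')%N -> (c' < b')%N -> (b' < f')%N ->
      crosses p [set a'; b']%SET [set c'; f']%SET.
    move=> h1 h2 h3.
    have [||||t [u [/andP[t0 t1] /andP[u0 u1] E]]] :=
      @segments_meet (p a') (p b') (p c') (p f'); try (apply: hp; lia).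
    exists ((1 - t) *: p a' + t *: p b'); split; first by exists a', b', t.
    by exists c', f', u.
  rewrite dE eE ccrossE chord_crossE; try lia.
  case/orP => /andP[/andP[h1 h2] h3]; first exact: key.
  by apply: crossesC; apply: key.
Qed.

Lemma triangulation_ctriangulation T : triangulation p T <-> ctriangulation T.
Proof.
split=> [[dT cT ncT]|[dT ncT cT]]; split=> //.
- by move=> d /dT/diagP.
- move=> d e dd ee; have [->|ne] := eqVneq d e; first exact: ccross_irr.
  apply/negP => /(crosses_ccross ((diagP d).1 (dT _ dd)) ((diagP e).1 (dT _ ee)) ne).2.
  exact: ncT.
- by move=> d /dT/diagP.
- move=> d e dd ee ne /(crosses_ccross (dT _ dd) (dT _ ee) ne).1.
  exact/negP/ncT.
Qed.

End Geometry.

(** * Rays and cones of the fan *)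

Section NormalFan.
Variables (R : realType) (V : vectType R).
Local Open Scope ring_scope.

Lemma polytope_face_neq0 (P : set (dual V)) (v : V) : polytope P ->
  exists x, polytope_face P v x.
Proof.
case=> s [s0 ->]; have s_gt0 : (0 < size s)%N by case: s s0.
pose i0 := Ordinal s_gt0.
case: (@Order.TotalTheory.arg_maxP _ R _ i0 predT (fun i : 'I_(size s) => s`_i v) isT).
move=> i _ imax; exists s`_i; split.
  exists (fun j => (j == i)%:R); split=> [j||]; first by rewrite ler0n.
  - by rewrite (bigD1 i) //= eqxx big1 ?addr0 // => j /negPf->.
  - rewrite (bigD1 i) //= eqxx scale1r big1 ?addr0 // => j /negPf->.
    by rewrite scale0r.
move=> y [c [c0 c1 ->]]; rewrite sum_lfunE -[leRHS]mul1r -c1 mulr_suml.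
by apply: ler_sum => j _; rewrite scale_lfunE; apply: ler_wpM2l => //; apply: imax.
Qed.

Lemma dualZ (phi : dual V) (c : R) (x : V) : phi (c *: x) = c * phi x.
Proof. exact: linearZ. Qed.

Lemma dual_sum (phi : dual V) (J : finType) (P : pred J) (F : J -> V) :
  phi (\sum_(j | P j) F j) = \sum_(j | P j) phi (F j).
Proof. exact: linear_sum. Qed.

(** [coord] with values in [R^o], so that [linfun] yields an element of the dual. *)
Definition coord_regular (m : nat) (X : m.-tuple V) (i : 'I_m) : V -> R^o := coord X i.

Fact coord_regular_is_linear m (X : m.-tuple V) i : linear (coord_regular X i).
Proof. by move=> c x y; rewrite /coord_regular linearP. Qed.

HB.instance Definition _ m (X : m.-tuple V) i :=
  GRing.isLinear.Build R V R^o *:%R (coord_regular X i) (coord_regular_is_linear X i).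

Definition coord_form m (X : m.-tuple V) i : dual V := linfun (coord_regular X i).

Lemma coord_formE m (X : m.-tuple V) i x : coord_form X i x = coord X i x.
Proof. by rewrite lfunE. Qed.

(* The second clause says that a cone [D] meets any other cone [C] in a face
   of [C]; this is all that is used of the fan axioms. *)
Definition complete_fan (F : set (set V)) : Prop :=
  (forall v, exists2 C, F C & C v) /\
  (forall C D x y, F C -> F D -> C x -> C y -> D (x + y) -> D x).

(** A point [z0] of the face defining [C] maximizes both [x] and [y]. A point maximizing [x + y]
    does as well as [z0] on the sum, hence on each summand. *)
Lemma normal_fan_complete (P : set (dual V)) : polytope P -> complete_fan (normal_fan P).
Proof.
move=> hP; split=> [v|C D x y [w' _ <-] [w _ <-] Cx Cy Dxy].
  by exists (normal_cone P (polytope_face P v)) => //; exists v.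
have [z0 /[dup]/Cx[Pz0 z0x] /Cy[_ z0y]] := polytope_face_neq0 w' hP.
move=> z /Dxy[Pz zxy]; split=> // y' Py'; apply: le_trans (z0x _ Py') _.
by have := zxy _ Pz0; have := z0y _ Pz; rewrite !linearD /=; lra.
Qed.

End NormalFan.

(** * Coordinates, rays and flips in a Santos fan *)

Section SantosFan.
Variables (R : realType) (n : nat) (p : 'I_n.+3 -> 'rV[R]_2).
Hypothesis hp : convex_polygon p.
Variables (T0 : {set {set 'I_n.+3}}) (V : vectType R).
Variables (alpha : n.-tuple V) (delta : n.-tuple {set 'I_n.+3}).
Hypotheses (hT0 : ctriangulation T0) (alphaB : basis_of fullv alpha) (deltaE : T0 =i delta).
Local Open Scope ring_scope.
Implicit Types (d e : {set 'I_n.+3}) (T : {set {set 'I_n.+3}}) (i j : 'I_n).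
Local Notation vec := (santos_vector p alpha delta).
Local Notation fan := (santos_fan p alpha delta).
Local Notation cone := (santos_cone p alpha delta).

Lemma delta_inj : injective (tnth delta).
Proof.
apply/tuple_uniqP/card_uniqP; rewrite size_tuple.
by case: hT0 => _ _ cT; rewrite -[RHS]cT; apply: eq_card => d; rewrite deltaE.
Qed.

Lemma delta_mem i : tnth delta i \in T0.
Proof. by rewrite deltaE mem_tnth. Qed.

Lemma delta_ex d : d \in T0 -> exists i, d = tnth delta i.
Proof. by rewrite deltaE => /tnthP. Qed.

Lemma delta_diag i : diag (tnth delta i).
Proof. by case: hT0 => dT0 _ _; apply/dT0/delta_mem. Qed.

Lemma santos_vector_seed i : vec (tnth delta i) = - tnth alpha i.
Proof.
rewrite /santos_vector; case: pickP => [j /eqP/delta_inj->//|/(_ i)].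
by rewrite eqxx.
Qed.

Lemma santos_vector_out d : diag d -> d \notin T0 ->
  vec d = \sum_(i < n | ccross d (tnth delta i)) tnth alpha i.
Proof.
move=> dd dN; rewrite /santos_vector; case: pickP => [i /eqP E|_].
  by rewrite -E delta_mem in dN.
apply: eq_bigl => i; have ne : d != tnth delta i.
  by apply: contraNneq dN => ->; apply: delta_mem.
apply/asboolP/idP => /(crosses_ccross hp dd (delta_diag i) ne) //.
Qed.

Lemma coord_alpha i j : coord alpha i (tnth alpha j) = (i == j)%:R.
Proof. by rewrite (tnth_nth 0) (coord_free _ _ (basis_free alphaB)) eq_sym. Qed.

Lemma coord_ext (x y : V) : (forall i, coord alpha i x = coord alpha i y) -> x = y.
Proof.
move=> E; rewrite (coord_basis alphaB (memvf x)) (coord_basis alphaB (memvf y)).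
by apply: eq_bigr => i _; rewrite E.
Qed.

Lemma coord_seed i j : coord alpha j (vec (tnth delta i)) = - (j == i)%:R.
Proof. by rewrite santos_vector_seed linearN /= coord_alpha. Qed.

Lemma coord_out d j : diag d -> d \notin T0 ->
  coord alpha j (vec d) = (ccross d (tnth delta j))%:R.
Proof.
move=> dd dN; rewrite santos_vector_out // linear_sum /=.
have [c|nc] := boolP (ccross d (tnth delta j)).
  rewrite (bigD1 j) //= coord_alpha eqxx big1 ?addr0 // => i /andP[_ ij].
  by rewrite coord_alpha eq_sym (negPf ij).
rewrite big1 // => i ci; rewrite coord_alpha; case: eqP => // ji.
by rewrite ji ci in nc.
Qed.

Lemma santos_vector_neq0 d : diag d -> vec d != 0.
Proof.
move=> dd; have [/delta_ex[i ->]|dN] := boolP (d \in T0).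
  apply/eqP => /(congr1 (coord alpha i)); rewrite coord_seed eqxx linear0.
  by move/eqP; rewrite oppr_eq0 oner_eq0.
have [e /delta_ex[i ->] de] := ctriangulation_crossed hT0 dd dN.
apply/eqP => /(congr1 (coord alpha i)); rewrite coord_out // de linear0.
by move/eqP; rewrite oner_eq0.
Qed.

(** Only seed vectors have a negative coordinate, and it locates the diagonal; outside the seed, the
    support lists the crossed seed diagonals. *)
Lemma santos_vector_inj d e (c : R) : diag d -> diag e -> 0 < c ->
  vec d = c *: vec e -> d = e.
Proof.
move=> dd de c0 E.
have Ei i : coord alpha i (vec d) = c * coord alpha i (vec e) by rewrite E linearZ.
have [/delta_ex[i di]|dN] := boolP (d \in T0); have [/delta_ex[j ej]|eN] := boolP (e \in T0).
- have := Ei i; rewrite di ej !coord_seed eqxx; have [->//|_] := eqVneq i j.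
  by rewrite oppr0 mulr0 => /eqP; rewrite oppr_eq0 oner_eq0.
- have := Ei i; rewrite di coord_seed coord_out // eqxx => H.
  have : 0 <= c * (ccross e (tnth delta i))%:R by rewrite mulr_ge0 ?ler0n // ltW.
  by rewrite -H oppr_ge0 ler10.
- have := Ei j; rewrite ej coord_seed coord_out // eqxx mulrN1 => H.
  have : 0 <= (ccross d (tnth delta j))%:R :> R by rewrite ler0n.
  by rewrite H oppr_ge0 leNgt c0.
- apply: (crossed_sub_eq hT0 dd dN de eN) => _ /delta_ex[i ->]; have := Ei i.
  rewrite !coord_out //; case: (ccross d _); case: (ccross e _) => //=.
    by rewrite mulr0 => /eqP; rewrite oner_eq0.
  by rewrite mulr1 => /esym/eqP; rewrite gt_eqF.
Qed.

Definition ray (x : V) : set V := [set y | exists2 c : R, 0 <= c & y = c *: x]%classic.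

Lemma santos_cone_gen T d (c : R) : d \in T -> 0 <= c -> cone T (c *: vec d).
Proof.
move=> dT c0; exists (fun e => if e == d then c else 0); split=> [e|].
  by case: ifP.
rewrite (bigD1 d) //= eqxx big1 ?addr0 // => e /andP[_ /negPf->].
by rewrite scale0r.
Qed.

Lemma santos_cone_ind T (phi : dual V) : {in T, forall e, 0 <= phi (vec e)} ->
  forall x, cone T x -> 0 <= phi x.
Proof.
move=> h x [c [c0 ->]]; rewrite dual_sum; apply: sumr_ge0 => e eT.
by rewrite dualZ; apply: mulr_ge0; [apply: c0|apply: h].
Qed.

Lemma santos_fan_cone T : ctriangulation T -> fan (cone T).
Proof.
move=> hT; exists T; split; first exact/(triangulation_ctriangulation hp).
exists 0; split=> [x _|]; first by rewrite lfunE.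
by apply/seteqP; split=> [x Cx|x []//]; split; rewrite // lfunE.
Qed.

Lemma santos_fan_ray_intro T d (phi : dual V) : ctriangulation T -> d \in T ->
  phi (vec d) = 0 -> {in T, forall e, e != d -> 0 < phi (vec e)} -> fan (ray (vec d)).
Proof.
move=> hT dT phid phie; exists T; split; first exact/(triangulation_ctriangulation hp).
have phi0 e : e \in T -> 0 <= phi (vec e).
  by move=> eT; have [->|/phie/ltW->//] := eqVneq e d; rewrite phid.
exists phi; split; first exact: santos_cone_ind.
apply/seteqP; split=> [x [c c0 ->]|x [[c [c0 xE]] /eqP]].
  by split; [exact: santos_cone_gen|rewrite dualZ phid; exact: mulr0].
rewrite {1}xE dual_sum psumr_eq0 => [/allP H|e eT]; last first.
  by rewrite dualZ; apply: mulr_ge0; [apply: c0|apply: phi0].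
exists (c d) => //; rewrite xE (bigD1 d) //= big1 ?addr0 // => e /andP[eT ed].
have := H e; rewrite mem_index_enum eT dualZ => /(_ isT)/=.
rewrite mulf_eq0 => /orP[/eqP->|]; first by rewrite scale0r.
by rewrite gt_eqF //; apply: phie.
Qed.

Lemma santos_fan_ray d : diag d -> fan (ray (vec d)).
Proof.
move=> dd; have [/delta_ex[i0 ->]|dN] := boolP (d \in T0).
  pose phi : dual V := - \sum_(i < n | i != i0) coord_form alpha i.
  apply: (santos_fan_ray_intro hT0 (phi := phi)).
  - exact: delta_mem.
  - rewrite opp_lfunE sum_lfunE big1 ?oppr0 // => i ii0.
    by rewrite coord_formE coord_seed (negPf ii0) oppr0.
  - move=> _ /delta_ex[j ->] jne; have {}jne : j != i0 by apply: contraNneq jne => ->.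
    rewrite opp_lfunE sum_lfunE (bigD1 j) //= coord_formE coord_seed eqxx.
    rewrite big1 ?addr0 ?opprK // => i /andP[_ ij].
    by rewrite coord_formE coord_seed (negPf ij) oppr0.
have [T [f [g [hT dT [/delta_ex[i1 fE] /delta_ex[i2 gE] df dg] TT0 TN]]]] :=
  ray_triangulation hT0 dd dN.
rewrite {}fE {}gE in df dg TN.
(* Outside the seed, the diagonals of [T] cross only what [d] crosses, so the sum vanishes and the
   first two terms give 1, or 0 for [d]. A seed diagonal of [T] is uncrossed by [d], so it
   contributes only to the sum and gets the value 1. *)
pose phi : dual V := coord_form alpha i1 - coord_form alpha i2
  - \sum_(i < n | ~~ ccross d (tnth delta i)) coord_form alpha i.
have phiE x : phi x = coord alpha i1 x - coord alpha i2 x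
    - \sum_(i < n | ~~ ccross d (tnth delta i)) coord alpha i x.
  rewrite /phi !add_lfunE !opp_lfunE sum_lfunE !coord_formE.
  by congr (_ - _); apply: eq_bigr => i _; rewrite coord_formE.
have phi_out e : diag e -> e \notin T0 -> crossed_sub T0 e d ->
    phi (vec e) = (ccross e (tnth delta i1))%:R - (ccross e (tnth delta i2))%:R.
  move=> de eN ed; rewrite phiE big1 ?subr0 ?coord_out // => i.
  rewrite coord_out //; case: (boolP (ccross e _)) => // c.
  by rewrite (ed _ (delta_mem i) c).
apply: (santos_fan_ray_intro hT dT (phi := phi)).
  by rewrite phi_out // df dg subrr.
move=> e eT ned; have [e0|eN] := boolP (e \in T0).
  have nde := TT0 _ eT e0; have [i iE] := delta_ex e0; rewrite {}iE in nde *.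
  have [ne1 ne2] : i1 != i /\ i2 != i.
    by split; apply: contraNneq nde => <-.
  rewrite phiE !coord_seed (negPf ne1) (negPf ne2) (bigD1 i) //= coord_seed eqxx.
  rewrite big1 ?addr0 => [|j /andP[_ /negPf ji]]; last by rewrite coord_seed ji oppr0.
  by rewrite oppr0 subr0 sub0r opprK ltr01.
have [ed e1 e2] := TN _ eT eN; have [dTT _ _] := hT.
rewrite phi_out ?e1 //; last exact: dTT.
by case: (boolP (ccross e _)) => [/e2 E|_]; [rewrite E eqxx in ned|rewrite subr0].
Qed.

(** The supporting functional vanishes on every generator that occurs in [x], so such a generator
    lies on the ray itself. *)
Lemma santos_ray_generator (x : V) : fan (ray x) -> x != 0 ->
  exists d (c : R), [/\ diag d, 0 < c & x = c *: vec d].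
Proof.
move=> [T [/(triangulation_ctriangulation hp) [dT _ _] [phi [phi0 rayE]]]] x0.
have : ray x x by exists 1; rewrite ?scale1r.
rewrite rayE => -[[c [c0 xE]] /eqP]; rewrite {1}xE dual_sum psumr_eq0; last first.
  by move=> e eT; apply: phi0; apply: santos_cone_gen.
move/allP => H.
have [d dd|] := pickP [pred d in T | c d != 0]; last first.
  move=> H0; case/eqP: x0; rewrite xE big1 // => e eT.
  by have := H0 e; rewrite /= eT => /negbFE/eqP->; rewrite scale0r.
have {dd} [dTT cd] := andP dd; have cd0 : 0 < c d by rewrite lt_def cd c0.
have : ray x (c d *: vec d).
  rewrite rayE; split; first exact: santos_cone_gen.
  by have := H d; rewrite mem_index_enum dTT => /(_ isT)/eqP.
case=> u u0 E; exists d, (u^-1 * c d).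
have vd := santos_vector_neq0 (dT _ dTT).
have un0 : u != 0.
  apply/eqP => uE; move/eqP: E; rewrite uE scale0r scaler_eq0 (negPf cd) /=.
  exact/negP.
have up : 0 < u by rewrite lt_def un0.
split; [exact: dT|by rewrite mulr_gt0 ?invr_gt0|].
by rewrite -scalerA E scalerA mulVf // scale1r.
Qed.

Section Complete.
Hypothesis fanC : complete_fan fan.

(** Split [vec d] into one nonzero term and the rest, both in [cone T]: the ray of [vec d] contains
    the sum, hence that term. *)
Lemma santos_vector_generator T d : ctriangulation T -> diag d -> cone T (vec d) -> d \in T.
Proof.
case: fanC => _ fan2 hT dd /[dup] Cd [c [c0 dE]]; have [dT _ _] := hT.
have [e /andP[/= eT ce]|H] := pickP [pred e in T | c e != 0]; last first.
  case/eqP: (santos_vector_neq0 dd); rewrite dE big1 // => e eT.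
  by have := H e; rewrite /= eT => /negbFE/eqP->; rewrite scale0r.
have ce0 : 0 < c e by rewrite lt_def ce c0.
have rest : cone T (\sum_(e' in T | e' != e) c e' *: vec e').
  exists (fun e' => if e' == e then 0 else c e'); split=> [e'|].
    by case: ifP.
  rewrite [RHS](bigD1 e) //= eqxx scale0r add0r.
  by apply: eq_bigr => e' /andP[_ /negPf->].
have : ray (vec d) (c e *: vec e).
  apply: (fan2 _ _ _ _ (santos_fan_cone hT) (santos_fan_ray dd) _ rest).
    exact: santos_cone_gen.
  by exists 1; rewrite ?ler01 // scale1r dE [RHS](bigD1 e).
case=> u u0 E; have un0 : u != 0.
  apply/eqP => uE; move/eqP: E; rewrite uE scale0r scaler_eq0 (negPf ce) /=.
  exact/negP/santos_vector_neq0/dT.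
have up : 0 < u by rewrite lt_def un0.
suff -> : d = e by [].
apply: (@santos_vector_inj d e (u^-1 * c e)) => //; first exact: dT.
  by rewrite mulr_gt0 ?invr_gt0.
by rewrite -scalerA E scalerA mulVf // scale1r.
Qed.

Lemma santos_fan_noncrossing C d e : fan C -> diag d -> diag e ->
  C (vec d) -> C (vec e) -> ~~ ccross d e.
Proof.
move=> [T [/(triangulation_ctriangulation hp) hT [phi [_ ->]]]] dd de [Cd _] [Ce _].
by case: (hT) => _ ncT _; apply: ncT; apply: santos_vector_generator.
Qed.

Lemma santos_flip i : exists2 d, diag d & vec d = tnth alpha i.
Proof.
case: fanC => /(_ (tnth alpha i))[C fanC_C Ca] _; move: fanC_C Ca.
move=> [T [/(triangulation_ctriangulation hp) hT [phi [_ ->]]]].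
move=> [[c [c0 aE]] _]; have [dT ncT _] := hT.
have aj j : (j == i)%:R = \sum_(e in T) c e * coord alpha j (vec e).
  rewrite -coord_alpha aE linear_sum; apply: eq_bigr => e _; exact: linearZ.
(* Nothing in [T] crosses [tnth delta j], so the [j]-th coordinate of [tnth alpha i] is minus this
   coefficient; yet it is 0 or 1. *)
have cseed j : tnth delta j \in T -> c (tnth delta j) = 0.
  move=> jT; have := aj j; rewrite (bigD1 (tnth delta j)) //= coord_seed eqxx big1.
    have := c0 (tnth delta j); have : 0 <= (j == i)%:R :> R by rewrite ler0n.
    by rewrite addr0 mulrN1; lra.
  move=> e /andP[eT ne]; have [/delta_ex[k ke]|eN] := boolP (e \in T0).
    rewrite ke coord_seed; have [jk|_] := eqVneq j k; last by rewrite oppr0 mulr0.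
    by rewrite ke jk eqxx in ne.
  by rewrite coord_out ?(negPf (ncT _ _ eT jT)) ?mulr0 //; apply: dT.
have ge0 e j : e \in T -> 0 <= c e * coord alpha j (vec e).
  move=> eT; have [/delta_ex[k ke]|eN] := boolP (e \in T0).
    by rewrite ke cseed ?mul0r // -ke.
  by rewrite coord_out ?mulr_ge0 ?ler0n //; apply: dT.
have [d /andP[/= dT' cd]|H] := pickP [pred e in T | c e * coord alpha i (vec e) != 0]; last first.
  have := aj i; rewrite eqxx big1 => [/eqP|e eT]; first by rewrite oner_eq0.
  by have := H e; rewrite /= eT => /negbFE/eqP.
have dd := dT _ dT'; exists d => //.
have [cd0 cdi] : c d != 0 /\ coord alpha i (vec d) != 0.
  by move: cd; rewrite mulf_eq0 negb_or => /andP[].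
have dN : d \notin T0.
  by apply: contra cd0 => /delta_ex[k ke]; rewrite ke cseed // -ke.
apply: coord_ext => j; rewrite coord_alpha coord_out //.
have [->|ji] := eqVneq j i.
  by move: cdi; rewrite coord_out //; case: ccross; rewrite // eqxx.
(* With the seed terms gone nothing can cancel, so a vector with positive coefficient has no
   coordinate other than [i]. *)
have /esym/eqP := aj j; rewrite (negPf ji) psumr_eq0 => [/allP/(_ d)|e eT]; last exact: ge0.
rewrite mem_index_enum dT' => /(_ isT); rewrite mulf_eq0 (negPf cd0) coord_out //=.
by move/eqP.
Qed.

End Complete.
End SantosFan.

(** * Linear isomorphisms of the fans *)

Section Small.
Local Open Scope ring_scope.

(** A triangle has only the empty triangulation, and the two diagonals of a square differ by a
    rotation. *)
Lemma ctriangulation_small n (T1 T2 : {set {set 'I_n.+3}}) : (n <= 1)%N ->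
  ctriangulation T1 -> ctriangulation T2 -> dihedral_equivalent T1 T2.
Proof.
case: n T1 T2 => [|[|//]] T1 T2 _ [dT1 _ c1] [dT2 _ c2].
  exists (fun i => i + 0); split; first by exists 0; left.
  by rewrite (cards0_eq c1) (cards0_eq c2) imset0.
have [d1 E1] := cards1P (introT eqP c1); have [d2 E2] := cards1P (introT eqP c2).
have earE d : diag d -> exists i, d = @ear 1 i.
  move=> /diag_ex[a [b [-> ab abN]]]; exists a; congr [set _; _]%SET.
  have lb := ltn_ord b; apply/eqP; rewrite ord_eqE val_succ2.
  by do ?[case: ifP => ?]; lia.
have [|i ei] := earE d1; first by apply: dT1; rewrite E1 set11.
have [|j ej] := earE d2; first by apply: dT2; rewrite E2 set11.
exists (fun x => x + (j - i)); split; first by exists (j - i); left.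
rewrite E1 imset_set1 E2 ei ej /ear imset_set2; congr [set [set _; _]]%SET.
  by rewrite addrC subrK.
by rewrite !(addrAC _ 1 (j - i)) [i + _]addrC subrK.
Qed.

End Small.

(** * From an isomorphism of fans to a dihedral symmetry *)

Section Forward.
Variables (R : realType) (n : nat) (p : 'I_n.+3 -> 'rV[R]_2).
Hypothesis hp : convex_polygon p.
Variables (T1 T2 : {set {set 'I_n.+3}}) (V1 V2 : vectType R).
Variables (alpha1 : n.-tuple V1) (alpha2 : n.-tuple V2).
Variables (delta1 delta2 : n.-tuple {set 'I_n.+3}).
Hypotheses (hT1 : ctriangulation T1) (hT2 : ctriangulation T2).
Hypotheses (alphaB1 : basis_of fullv alpha1) (alphaB2 : basis_of fullv alpha2).
Hypotheses (deltaE1 : T1 =i delta1) (deltaE2 : T2 =i delta2).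
Local Open Scope ring_scope.
Implicit Types (d e : {set 'I_n.+3}) (T : {set {set 'I_n.+3}}) (i j : 'I_n).
Local Notation vec1 := (santos_vector p alpha1 delta1).
Local Notation vec2 := (santos_vector p alpha2 delta2).
Local Notation fan1 := (santos_fan p alpha1 delta1).
Local Notation fan2 := (santos_fan p alpha2 delta2).
Local Notation cone1 := (santos_cone p alpha1 delta1).
Local Notation cone2 := (santos_cone p alpha2 delta2).

Section Isomorphism.
Hypotheses (fanC1 : complete_fan fan1) (fanC2 : complete_fan fan2).
Variable f : 'Hom(V1, V2).
Hypotheses (f_inj : injective f) (f_fan : forall C, fan1 C -> fan2 (f @` C)%classic).

Lemma image_ray (x : V1) : (f @` ray x)%classic = ray (f x).
Proof.
apply/seteqP; split=> [_ [_ [c c0 ->] <-]|_ [c c0 ->]]; first by exists c; rewrite ?linearZ.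
by exists (c *: x); rewrite ?linearZ //; exists c.
Qed.

Lemma isomorphism_diag : exists phi : {set 'I_n.+3} -> {set 'I_n.+3},
  forall d, diag d -> diag (phi d) /\
    exists2 c : R, 0 < c & f (vec1 d) = c *: vec2 (phi d).
Proof.
suff H d : exists e, diag d -> diag e /\
    exists2 c : R, 0 < c & f (vec1 d) = c *: vec2 e.
  by have [phi phiP] := choice H; exists phi.
have [dd|nd] := boolP (diag d); last by exists d.
have fr : fan2 (ray (f (vec1 d))).
  by rewrite -image_ray; apply/f_fan/(santos_fan_ray hp hT1 alphaB1 deltaE1 dd).
have [|e [c [de c0 E]]] := santos_ray_generator hp hT2 alphaB2 deltaE2 fr.
  rewrite -(linear0 f) (inj_eq f_inj).
  exact: (santos_vector_neq0 hp hT1 alphaB1 deltaE1).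
by exists e => _; split=> //; exists c.
Qed.

Lemma isomorphism_dihedral : (1 < n)%N -> exists s, dihedral s /\
  forall d, diag d -> exists2 c : R, 0 < c & f (vec1 d) = c *: vec2 (s @: d).
Proof.
move=> n1; have [phi phiP] := isomorphism_diag.
have [||d e dd de nc|s [hs sE]] := @automorphism_dihedral n phi n1.
- by move=> d /phiP[].
- move=> d e dd de E; have [_ [c c0 cE]] := phiP _ dd; have [_ [u u0 uE]] := phiP _ de.
  apply: (santos_vector_inj hp hT1 alphaB1 deltaE1 dd de (c := c / u)).
    by rewrite divr_gt0.
  apply: f_inj; rewrite linearZ /= uE scalerA divfK ?gt_eqF //.
  by rewrite cE E.
(* Noncrossing diagonals lie in a common triangulation, so their vectors lie in one cone; its image
   is a cone of the second fan. *)
- have [T [sT dT ncT cT]] : exists T, [/\ [set d; e]%SET \subset T,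
      {in T, forall d, diag d}, noncrossing T & #|T| = n].
    apply: noncrossing_extend => [x /set2P[]->//|x y].
    move=> /set2P[]-> /set2P[]->; [exact: ccross_irr|exact: nc| |exact: ccross_irr].
    by rewrite ccrossC; apply: nc.
  have hT : ctriangulation T by [].
  have fT := f_fan (santos_fan_cone hp alpha1 delta1 hT).
  have mem x : x \in [set d; e]%SET -> diag x -> (f @` cone1 T)%classic (vec2 (phi x)).
    move=> xde dx; have [_ [c c0 cE]] := phiP _ dx.
    exists (c^-1 *: vec1 x).
      by apply: santos_cone_gen; [apply: (subsetP sT)|rewrite invr_ge0 ltW].
    by rewrite linearZ /= cE scalerA mulVf ?gt_eqF // scale1r.
  apply: (santos_fan_noncrossing hp hT2 alphaB2 deltaE2 fanC2 fT).
  + by have [] := phiP _ dd.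
  + by have [] := phiP _ de.
  + by apply: mem; rewrite ?set21.
  + by apply: mem; rewrite ?set22.
- exists s; split=> // d dd; have [_ [c c0 cE]] := phiP _ dd.
  by exists c; rewrite // -sE.
Qed.

(* The sign of [x.2] is negative when the isomorphism exchanges a seed diagonal
   with its flip. *)
Lemma isomorphism_basis (s : 'I_n.+3 -> 'I_n.+3) : dihedral s ->
  (forall d, diag d -> exists2 c : R, 0 < c & f (vec1 d) = c *: vec2 (s @: d)) ->
  forall i, exists x : 'I_n * R, [/\ x.2 != 0,
    f (tnth alpha1 i) = x.2 *: tnth alpha2 x.1 &
    s @: tnth delta1 i \notin T2 -> x.2 < 0].
Proof.
move=> hs sP i; have dd := delta_diag hT1 deltaE1 i.
have [c c0] := sP _ dd.
rewrite (santos_vector_seed _ _ hT1 deltaE1) linearN /= => cE.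
have [/(delta_ex deltaE2)[j jE]|dN] := boolP (s @: tnth delta1 i \in T2).
  exists (j, c); split=> //=; first by rewrite gt_eqF.
  apply: oppr_inj; rewrite cE jE (santos_vector_seed _ _ hT2 deltaE2).
  by rewrite scalerN.
have [e de eE] := santos_flip hp hT1 alphaB1 deltaE1 fanC1 i.
have [u u0] := sP _ de; rewrite eE => uE.
have [/(delta_ex deltaE2)[j jE]|eN] := boolP (s @: e \in T2).
  exists (j, - u); split=> /=; rewrite ?oppr_eq0 ?gt_eqF ?oppr_lt0 //.
  by rewrite uE jE (santos_vector_seed _ _ hT2 deltaE2) scalerN scaleNr.
(* If neither image were in [T2], [f (tnth alpha1 i)] and its opposite would both have nonnegative
   coordinates, one of them nonzero. *)
have dsd := dihedral_diag hs dd; have dse := dihedral_diag hs de.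
have [g /(delta_ex deltaE2)[j ->] gd] := ctriangulation_crossed hT2 dsd dN.
have := congr1 (coord alpha2 j) cE.
rewrite uE linearN !linearZ /= !(coord_out hp hT2 alphaB2 deltaE2) // gd mulr1 => H.
have : 0 <= u * (ccross (s @: e) (tnth delta2 j))%:R by rewrite mulr_ge0 ?ler0n // ltW.
by rewrite -oppr_le0 H leNgt c0.
Qed.

Lemma isomorphism_seed (s : 'I_n.+3 -> 'I_n.+3) : (1 < n)%N -> dihedral s ->
  (forall d, diag d -> exists2 c : R, 0 < c & f (vec1 d) = c *: vec2 (s @: d)) ->
  forall i, s @: tnth delta1 i \in T2.
Proof.
move=> n1 hs sP i0; apply: contraT => i0N.
have [x xP] := choice (isomorphism_basis hs sP).
pose sg i := (x i).1; pose l i := (x i).2.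
have l0 i : l i != 0 by case: (xP i).
have fE i : f (tnth alpha1 i) = l i *: tnth alpha2 (sg i) by case: (xP i).
have lN : l i0 < 0 by case: (xP i0) => _ _; apply.
have sgI : injective sg.
  move=> i j E; apply: contraTeq (l0 j) => ij.
  have : f (l j *: tnth alpha1 i) = f (l i *: tnth alpha1 j).
    by rewrite !linearZ /= !fE E !scalerA mulrC.
  move/f_inj/(congr1 (coord alpha1 i)); rewrite !linearZ /= !(coord_alpha alphaB1).
  by rewrite eqxx (negPf ij) mulr1 mulr0 => ->; rewrite eqxx.
have [i1 i10] : exists i1, i1 != i0.
  have [lt0|] := posnP i0.
    by exists (Ordinal n1); apply/eqP => /(congr1 val) /=; rewrite lt0.
  move=> gt0; have n0 : (0 < n)%N by lia.
  by exists (Ordinal n0); apply/eqP => /(congr1 val) /= E; rewrite -E in gt0.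
have [_ ncT1 _] := hT1.
have m0 := delta_mem deltaE1 i0; have m1 := delta_mem deltaE1 i1.
have [|e /andP[e0 e1]] := common_crosser (delta_diag hT1 deltaE1 i0)
  (delta_diag hT1 deltaE1 i1) _ (ncT1 _ _ m0 m1).
  by rewrite (inj_eq (delta_inj hT1 deltaE1)) eq_sym.
have de := ccross_diag e0.
have eN : e \notin T1 by apply: contraL e0 => eT; apply: ncT1.
have [c c0 cE] := sP _ de.
have co i : ccross e (tnth delta1 i) ->
    l i = c * coord alpha2 (sg i) (vec2 (s @: e)).
  move=> ei; have := congr1 (coord alpha2 (sg i)) cE; rewrite linearZ /= => <-.
  rewrite (santos_vector_out hp _ hT1 deltaE1) // !linear_sum /= (bigD1 i) //=.
  rewrite fE linearZ /= (coord_alpha alphaB2) eqxx mulr1 big1 ?addr0 // => j /andP[_ ji].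
  by rewrite fE linearZ /= (coord_alpha alphaB2) (inj_eq sgI) eq_sym (negPf ji) mulr0.
have [/(delta_ex deltaE2)[k kE]|seN] := boolP (s @: e \in T2).
  have := co _ e0; have := co _ e1.
  rewrite kE !(coord_seed p hT2 alphaB2 deltaE2).
  have [E0 H _|_ _ H] := eqVneq (sg i0) k; last by rewrite H oppr0 mulr0 ltxx in lN.
  by move: (l0 i1); rewrite H -E0 (inj_eq sgI) (negPf i10) oppr0 mulr0 eqxx.
have := co _ e0; rewrite (coord_out hp hT2 alphaB2 deltaE2) ?(dihedral_diag hs) // => H.
by move: lN; rewrite H ltNge mulr_ge0 ?ler0n // ltW.
Qed.

Lemma isomorphism_equivalent : (1 < n)%N -> dihedral_equivalent T1 T2.
Proof.
move=> n1; have [s [hs sP]] := isomorphism_dihedral n1; exists s; split=> //.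
have [_ _ c1] := hT1; have [_ _ c2] := hT2.
apply/esym/eqP; rewrite eqEcard card_imset ?c1 ?c2 ?leqnn ?andbT; last first.
  exact/imset_inj/dihedral_inj.
apply/subsetP => _ /imsetP[d /(delta_ex deltaE1)[i ->] ->].
exact: isomorphism_seed.
Qed.

End Isomorphism.
End Forward.

(** * From a dihedral symmetry to an isomorphism of fans *)

Section Backward.
Variables (R : realType) (n : nat) (p : 'I_n.+3 -> 'rV[R]_2).
Hypothesis hp : convex_polygon p.
Local Open Scope ring_scope.

Lemma basis_hom (V1 V2 : vectType R) (alpha1 : n.-tuple V1) (beta : 'I_n -> V2) :
  basis_of fullv alpha1 -> exists f : 'Hom(V1, V2), forall i, f (tnth alpha1 i) = beta i.
Proof.
move=> B; have [g gP] := linear_of_free alpha1 [tuple beta i | i < n].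
exists (linfun g) => i; rewrite lfunE /= (tnth_nth 0) -(nth_map _ 0) ?size_tuple //.
by rewrite gP ?(basis_free B) ?size_tuple // -tnth_nth tnth_mktuple.
Qed.

Variables (T1 T2 : {set {set 'I_n.+3}}) (V1 V2 : vectType R).
Variables (alpha1 : n.-tuple V1) (alpha2 : n.-tuple V2).
Variables (delta1 delta2 : n.-tuple {set 'I_n.+3}).
Hypotheses (hT1 : ctriangulation T1) (hT2 : ctriangulation T2).
Hypotheses (alphaB1 : basis_of fullv alpha1) (alphaB2 : basis_of fullv alpha2).
Hypotheses (deltaE1 : T1 =i delta1) (deltaE2 : T2 =i delta2).
Implicit Types (d e : {set 'I_n.+3}) (T : {set {set 'I_n.+3}}) (i j : 'I_n).
Local Notation vec1 := (santos_vector p alpha1 delta1).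
Local Notation vec2 := (santos_vector p alpha2 delta2).
Local Notation fan1 := (santos_fan p alpha1 delta1).
Local Notation fan2 := (santos_fan p alpha2 delta2).
Local Notation cone1 := (santos_cone p alpha1 delta1).
Local Notation cone2 := (santos_cone p alpha2 delta2).

(** The map matches the bases as [s] matches the seeds. Since [s] preserves crossings, it sends the
    vector of [d] to that of [s @: d], and a face cut out by [phi] to the face cut out by [phi]
    composed with the inverse map. *)
Lemma dihedral_isomorphism (s : 'I_n.+3 -> 'I_n.+3) : dihedral s ->
  T2 = [set s @: d | d : {set 'I_n.+3} in T1]%SET ->
  linearly_isomorphic fan1 fan2.
Proof.
move=> hs T2E; have sI := dihedral_inj hs; have imI := imset_inj sI.
have sgP i : exists j, s @: tnth delta1 i = tnth delta2 j.
  by apply: (delta_ex deltaE2); rewrite T2E imset_f // delta_mem.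
have [sg sgE] := choice sgP.
have sgI : injective sg.
  move=> i j E; apply: (delta_inj hT1 deltaE1); apply: imI.
  by rewrite !sgE E.
have [tg sgK tgK] : bijective sg by apply: injF_bij.
have [f fE] := basis_hom (fun i => tnth alpha2 (sg i)) alphaB1.
have [g gE] := basis_hom (fun i => tnth alpha1 (tg i)) alphaB2.
have fK : cancel f g.
  move=> x; rewrite {1}(coord_basis alphaB1 (memvf x)) {2}(coord_basis alphaB1 (memvf x)).
  rewrite !linear_sum /=; apply: eq_bigr => i _.
  by rewrite !linearZ /= -tnth_nth fE gE sgK.
have gK : cancel g f.
  move=> x; rewrite {1}(coord_basis alphaB2 (memvf x)) {2}(coord_basis alphaB2 (memvf x)).
  rewrite !linear_sum /=; apply: eq_bigr => i _.
  by rewrite !linearZ /= -tnth_nth gE fE tgK.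
have fvec d : diag d -> f (vec1 d) = vec2 (s @: d).
  move=> dd; have [/(delta_ex deltaE1)[i ->]|dN] := boolP (d \in T1).
    rewrite sgE (santos_vector_seed _ _ hT1 deltaE1).
    by rewrite (santos_vector_seed _ _ hT2 deltaE2) linearN /= fE.
  have sN : s @: d \notin T2 by rewrite T2E mem_imset.
  rewrite (santos_vector_out hp _ hT1 deltaE1) // linear_sum /=.
  rewrite (santos_vector_out hp _ hT2 deltaE2) ?(dihedral_diag hs) //.
  rewrite [RHS](reindex sg) /=; last by exists tg => ? _.
  by apply: eq_big => [i|i _]; rewrite ?fE // -sgE dihedral_ccrossE.
have fcone T : ctriangulation T ->
    (f @` cone1 T)%classic = cone2 [set s @: d | d : {set 'I_n.+3} in T]%SET.
  move=> [dT _ _]; have [t [ht ts]] := dihedral_inv hs.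
  have tsI d : t @: (s @: d) = d.
    apply: imI; rewrite -!imset_comp -[RHS]imset_id -imset_comp.
    by apply: eq_imset => i /=; rewrite ts.
  apply/seteqP; split=> [_ [x [c [c0 ->]] <-]|y [c [c0 ->]]].
    exists (fun e => c (t @: e)); split=> [e|]; first exact: c0.
    rewrite big_imset /=; last by move=> ? ? _ _; apply: imI.
    rewrite linear_sum; apply: eq_bigr => d dd.
    by rewrite linearZ /= fvec ?tsI //; apply: dT.
  exists (\sum_(d in T) c (s @: d) *: vec1 d).
    by exists (fun d => c (s @: d)).
  rewrite big_imset /=; last by move=> ? ? _ _; apply: imI.
  rewrite linear_sum; apply: eq_bigr => d dd.
  by rewrite linearZ /= fvec //; apply: dT.
exists f; split; first by exists g.
move=> _ [T [/(triangulation_ctriangulation hp) hT [phi [phi0 ->]]]].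
exists [set s @: d | d : {set 'I_n.+3} in T]%SET; split.
  exact/(triangulation_ctriangulation hp)/dihedral_ctriangulation.
rewrite -fcone //; exists (phi \o g)%VF; split.
  by move=> _ [x Cx <-]; rewrite comp_lfunE fK; apply: phi0.
apply/seteqP; split=> [_ [x [Cx px] <-]|_ [[x Cx <-]]].
  by split; [exists x|rewrite comp_lfunE fK].
by rewrite comp_lfunE fK => px; exists x.
Qed.

End Backward.

Theorem corollary5p7 (R : realType) (n : nat) (p : 'I_n.+3 -> 'rV[R]_2)
    (hp : convex_polygon p) (T1 T2 : {set {set 'I_n.+3}})
    (hT1 : triangulation p T1) (hT2 : triangulation p T2)
    (V1 V2 : vectType R) (P1 : set (dual V1)) (P2 : set (dual V2))
    (hP1 : santos_associahedron p T1 P1) (hP2 : santos_associahedron p T2 P2) :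
  normally_isomorphic P1 P2 <-> dihedral_equivalent T1 T2.
Proof.
have cT1 := (triangulation_ctriangulation hp T1).1 hT1.
have cT2 := (triangulation_ctriangulation hp T2).1 hT2.
case: hP1 => [alpha1 [delta1 [B1 E1 /normal_fan_complete fC1 F1]]].
case: hP2 => [alpha2 [delta2 [B2 E2 /normal_fan_complete fC2 F2]]].
rewrite /normally_isomorphic {}F1 {}F2 in fC1 fC2 *; split.
  case=> f [/bij_inj f_inj f_fan]; have [n1|n1] := leqP n 1.
    exact: ctriangulation_small.
  exact: (isomorphism_equivalent hp cT1 cT2 B1 B2 E1 E2 fC1 fC2 f_inj f_fan).
case=> s [hs T2E]; exact: (dihedral_isomorphism hp cT1 cT2 B1 B2 E1 E2 hs T2E).
Qed.
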